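(* Let $\mathbb V$ be an $N_K=N$ SUSY vertex algebra with odd translation operators $D^1,\dots,D^N$, and let $\gamma$ be a complex number or a formal variable. Then the operators $D^k$ ($k=1,\dots,N$) induce odd differentials (odd derivations of square zero) of the superalgebra $\widetilde A_\gamma(\mathbb V)$, given by $[a]\mapsto[D^ka]$.
   Context: Everything is over $\mathbb C$ and in the super sense. When $\gamma$ is a complex number, $\mathbb V[\gamma]$ means $\mathbb V$ and $\mathbb C[\gamma]$ means $\mathbb C$. Let $N\ge1$, $[N]=\{1,\dots,N\}$, $Z=(z,\zeta^1,\dots,\zeta^N)$ with $z$ an even and $\zeta^i$ odd indeterminates, $Z^{j|J}=z^j\zeta^{j_1}\cdots\zeta^{j_r}$ for $J=\{j_1<\dots<j_r\}\subset[N]$. For a superspace $\mathbb V$, $\mathbb V[[Z^{\pm1}]]=\mathbb V[[z^{\pm1}]][\zeta^1,\dots,\zeta^N]$, $\mathbb V((Z))=\mathbb V((z))[\zeta^1,\dots,\zeta^N]$. An $N_K=N$ SUSY vertex algebra (Heluani–Kac) is $(\mathbb V,Y,\mathbf 1,D^1,\dots,D^N)$: a superspace $\mathbb V$, an even linear map $a\mapsto Y(a,Z)=a(Z)=\sum_{j\in\mathbb Z,J\subset[N]}Z^{-1-j|[N]\setminus J}a_{(j|J)}\in(\mathrm{End}\,\mathbb V)[[Z^{\pm1}]]$, a nonzero even vector $\mathbf 1$, and odd operators $D^k$ on $\mathbb V$ (the odd translation operators), such that for all $a,b$: (i) $a(Z)b\in\mathbb V((Z))$; (ii) $Y(\mathbf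 1,Z)=\mathrm{id}$, $a(Z)\mathbf 1=a+O(Z)$, $D^k\mathbf 1=0$; (iii) $[D^k,a(Z)]=(\partial_{\zeta^k}-\zeta^k\partial_z)a(Z)$; (iv) $(z-w)^M[a(Z),b(W)]=0$ for some $M\in\mathbb N$. Operations: for $a,b\in\mathbb V$, $n\ge1$, $$a\bullet^\gamma_nb:=\mathrm{Res}_z\Bigl[\frac{\gamma^ne^{\gamma z}}{(e^{\gamma z}-1)^n}a(z,0,\dots,0)b\Bigr]dz\quad(\gamma\neq0\text{ or formal}),\qquad a\bullet^{\gamma=0}_nb:=a_{(-n|[N])}b,$$ where for formal $\gamma$ the kernel is expanded in $\mathbb Q[\gamma]((z))$. Zhu algebra: $\widetilde A_\gamma(\mathbb V)=\mathbb V[\gamma]/\widetilde O_\gamma(\mathbb V)$, $\widetilde O_\gamma(\mathbb V)=\mathrm{Span}_{\mathbb C[\gamma]}\{a\bullet^\gamma_nb\mid a,b\in\mathbb V,n\ge2\}$; it is a unital associative superalgebra with product $[a]\bullet^\gamma[b]=[a\bullet^\gamma_1b]$ and unit $[\mathbf 1]$. *)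

(* Defs.v *)
From HB Require Import structures.
From mathcomp Require Import all_boot all_order all_algebra.
From mathcomp Require Import generic_quotient ring_quotient complex.
From mathcomp Require Import boolp classical_sets functions cardinality fsbigop reals.

Set Implicit Arguments.
Unset Strict Implicit.
Unset Printing Implicit Defensive.

Import Order.TTheory GRing.Theory Num.Theory.
Local Open Scope ring_scope.

(* Superspaces.  [gr false] and [gr true] are the even and odd parts.  Signs
   are only ever attached to homogeneous elements; the corresponding
   identities for arbitrary elements follow by linearity. *)

Record supergrading (K : pzRingType) (V : lmodType K) (gr : bool -> set V)
  : Prop := SuperGrading {
  gr0 : forall p, gr p 0;
  gr_lin : forall p (c : K) u v, gr p u -> gr p v -> gr p (c *: u + v);
  gr_split : forall v, exists v0 v1, [/\ gr false v0, gr true v1 & v = v0 + v1];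
  gr_direct : forall v, gr false v -> gr true v -> v = 0 }.

(* Formal distributions.  [F m K] is the coefficient, placed on the right, of
   Z^{m|K} = z^m zeta^{k_1} ... zeta^{k_r} in an (End V)-valued series F; the
   odd indeterminates anticommute with each other and with the odd elements
   of End V. *)

Section Distributions.
Variables (C : fieldType) (N : nat) (V : lmodType C).

Definition distr := int -> {set 'I_N} -> V -> V.
Definition distr2 := int -> int -> {set 'I_N} -> {set 'I_N} -> V -> V.

(* The number of odd indeterminates that zeta^k, or its derivation, must cross
   to reach its place in zeta^K. *)
Definition nbefore (k : 'I_N) (K : {set 'I_N}) : nat := #|[set i in K | (i < k)%N]|.

Definition dz (F : distr) : distr :=
  fun m K v => (m + 1)%:~R *: F (m + 1) K v.

Definition dzeta (k : 'I_N) (F : distr) : distr :=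
  fun m K v =>
    if k \in K then 0 else (-1) ^+ nbefore k K *: F m (k |: K) v.

Definition mul_zeta (k : 'I_N) (F : distr) : distr :=
  fun m K v =>
    if k \in K then (-1) ^+ nbefore k K *: F m (K :\ k) v else 0.

(* [T, F(Z)] = T F(Z) - (-1)^p F(Z) T for T an odd operator and F of parity
   p; moving T across zeta^K gives the sign (-1)^|K|. *)
Definition odd_bracket (T : V -> V) (p : bool) (F : distr) : distr :=
  fun m K v => (-1) ^+ #|K| *: T (F m K v) - (-1) ^+ p *: F m K (T v).

(* [F(Z), G(W)] = F(Z) G(W) - (-1)^{pq} G(W) F(Z) for F, G of parities p, q.
   The entry at m n K L is the coefficient of z^m w^n zeta^K omega^L, where
   W = (w, omega^1, ..., omega^N).  Since F m K has parity p + |K|, moving it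
   across omega^L gives the first sign; in the second product, G n L and
   omega^L are moved across zeta^K, with total sign
   (-1)^{(q + |L|)|K| + |L||K|} = (-1)^{q|K|}. *)
Definition bracket (p q : bool) (F G : distr) : distr2 :=
  fun m n K L v =>
    (-1) ^+ ((p + #|K|) * #|L|) *: F m K (G n L v)
    - (-1) ^+ (p * q + q * #|K|) *: G n L (F m K v).

Definition mul_zw (H : distr2) : distr2 :=
  fun m n K L v => H (m - 1) n K L v - H m (n - 1) K L v.

End Distributions.

(* N_K = N SUSY vertex algebras.  [mode a j J] is a_{(j|J)}. *)

Definition field_of (C : fieldType) (N : nat) (V : lmodType C)
    (mode : V -> int -> {set 'I_N} -> {linear V -> V}) (a : V) : distr N V :=
  fun m K => mode a (- 1 - m) (~: K).

Record susy_va (C : fieldType) (N : nat) (V : lmodType C) := SusyVA {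
  gr : bool -> set V;
  mode : V -> int -> {set 'I_N} -> {linear V -> V};
  vac : V;
  oddT : 'I_N -> {linear V -> V};
  gr_super : supergrading gr;
  mode_linear : forall j J b, linear (fun a => mode a j J b);
  mode_even : forall p q a b j J, gr p a -> gr q b ->
    gr (p (+) odd #|~: J| (+) q) (mode a j J b);
  vac_even : gr false vac;
  vac_neq0 : vac <> 0;
  oddT_odd : forall k p a, gr p a -> gr (~~ p) (oddT k a);
  field_laurent : forall a b, exists B : int, forall m K, m < B ->
    field_of mode a m K b = 0;
  field_vac : forall m K v,
    field_of mode vac m K v = if (m == 0) && (K == finset.set0) then v else 0;
  field_on_vac_reg : forall a m K, m < 0 -> field_of mode a m K vac = 0;
  field_on_vac_val : forall a, field_of mode a 0 finset.set0 vac = a;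
  oddT_vac : forall k, oddT k vac = 0;
  translation : forall k p a, gr p a -> forall m K v,
    odd_bracket (oddT k) p (field_of mode a) m K v =
    dzeta k (field_of mode a) m K v - mul_zeta k (dz (field_of mode a)) m K v;
  locality : forall p q a b, gr p a -> gr q b -> exists M : nat, forall m n K L v,
    iter M (@mul_zw C N V)
      (bracket p q (field_of mode a) (field_of mode b)) m n K L v = 0 }.

(* The kernel gamma^n e^{gamma z} / (e^{gamma z} - 1)^n in K((z)).  Power
   series are represented by their coefficients.  As
   e^{gamma z} - 1 = gamma z phi(z) with phi(0) = 1, the kernel is
   z^{-n} e^{gamma z} phi(z)^{-n}; see [zhu_kernelP]. *)

Section Kernel.
Variable K : comUnitRingType.

Definition psmul (f g : nat -> K) : nat -> K :=
  fun n => \sum_(i < n.+1) f i * g (n - i)%N.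
Definition psone : nat -> K := fun n => (n == 0%N)%:R.
Definition pspow (f : nat -> K) (k : nat) : nat -> K := iter k (psmul f) psone.

(* The geometric series sum_k (1 - f)^k, for f with constant term 1. *)
Definition psinv (f : nat -> K) : nat -> K :=
  fun n => \sum_(k < n.+1) pspow (fun i => psone i - f i) k n.

Definition psexp (g : K) : nat -> K := fun n => g ^+ n / n`!%:R.
Definition psphi (g : K) : nat -> K := fun n => g ^+ n / n.+1`!%:R.

Definition zhu_kernel (g : K) (n : nat) (i : int) : K :=
  if i + n%:Z is Posz m
  then psmul (psexp g) (pspow (psinv (psphi g)) n) m else 0.

End Kernel.

Section KernelTheory.
Variable K : comUnitRingType.
Implicit Types f g h : nat -> K.

Let tr m f : {poly K} := \poly_(i < m) f i.

Let psmul_tr m f g n : (n < m)%N -> psmul f g n = (tr m f * tr m g)`_n.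
Proof.
move=> nm; rewrite coefM; apply: eq_bigr => i _; rewrite !coef_poly.
by rewrite (leq_ltn_trans _ nm) ?(leq_ltn_trans (leq_subr _ _) nm) // -ltnS.
Qed.

Lemma psmulC f g : psmul f g = psmul g f.
Proof. by apply/funext => n; rewrite !(psmul_tr _ _ (ltnSn n)) mulrC. Qed.

Lemma psmulA f g h : psmul f (psmul g h) = psmul (psmul f g) h.
Proof.
have coefMt (p q r : {poly K}) n :
    (forall i, (i <= n)%N -> q`_i = r`_i) -> (p * q)`_n = (p * r)`_n.
  by move=> e; rewrite !coefM; apply: eq_bigr => i _; rewrite e ?leq_subr.
have trM m f' g' i : (i < m)%N -> (tr m (psmul f' g'))`_i = (tr m f' * tr m g')`_i.
  by move=> im; rewrite coef_poly im (psmul_tr _ _ im).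
apply/funext => n; rewrite !(psmul_tr _ _ (ltnSn n)).
rewrite (coefMt _ _ (tr n.+1 g * tr n.+1 h)) => [|i le_in]; last exact: trM.
rewrite mulrA mulrC [in RHS]mulrC; apply: coefMt => i le_in.
by rewrite trM.
Qed.

Lemma psmul1 f : psmul (@psone K) f = f.
Proof.
apply/funext => n; rewrite /psmul big_ord_recl /psone /= mul1r subn0.
by rewrite big1 ?addr0 // => i _; rewrite mul0r.
Qed.

Lemma pspowS f k : pspow f k.+1 = psmul f (pspow f k). Proof. by []. Qed.

Lemma pspowM f g k : pspow (psmul f g) k = psmul (pspow f k) (pspow g k).
Proof.
elim: k => [|k IH]; first by rewrite /pspow /= psmul1.
rewrite !pspowS IH -!psmulA; congr psmul.
by rewrite !psmulA; congr psmul; rewrite psmulC.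
Qed.

Lemma pspow1 k : pspow (@psone K) k = @psone K.
Proof. by elim: k => // k IH; rewrite pspowS IH psmul1. Qed.

Lemma pspow_lt f k n : f 0%N = 0 -> (n < k)%N -> pspow f k n = 0.
Proof.
move=> f0; elim: k n => // k IH n nk; rewrite pspowS /psmul big1 // => i _.
have [->|i0] := eqVneq (i : nat) 0%N; first by rewrite f0 mul0r.
by rewrite IH ?mulr0 // -ltnS (leq_trans _ nk) // ltnS ltn_subrL lt0n i0 /=; case: (n) i i0 => // -[[]].
Qed.

Lemma psmulV f : f 0%N = 1 -> psmul f (psinv f) = @psone K.
Proof.
move=> f0; pose h := fun i => psone K i - f i.
have h0 : h 0%N = 0 by rewrite /h f0 subrr.
have invE n m : (n <= m)%N -> psinv f n = \sum_(k < m.+1) pspow h k n.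
  move=> nm; rewrite /psinv -!(big_mkord predT (fun k => pspow h k n)).
  rewrite [RHS](big_cat_nat (n := n.+1)) //= [X in _ + X]big_nat_cond.
  by rewrite [X in _ + X]big1 ?addr0 // => i /andP[/andP[ni _] _]; apply: pspow_lt.
have fE : f = fun i => psone K i - h i by apply/funext => i; rewrite /h subKr.
apply/funext => n; rewrite {1}fE /psmul.
under eq_bigr => i _ do rewrite (@invE _ n (leq_subr _ _)) mulrBl !mulr_sumr.
rewrite sumrB exchange_big [X in _ - X]exchange_big /=.
transitivity (\sum_(0 <= k < n.+1) (pspow h k n - pspow h k.+1 n)).
  rewrite big_mkord sumrB; congr (_ - _); apply: eq_bigr => k _ //.
  exact: (congr1 (fun F => F n) (psmul1 _)).
rewrite (@telescope_sumr_eq _ _ _ (fun k => - pspow h k n)) //.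
  by rewrite (pspow_lt h0 (ltnSn n)) oppr0 add0r opprK.
by move=> k _; rewrite opprK addrC.
Qed.

(* (e^{gamma z} - 1)^n * (z^n * kernel) = gamma^n z^n e^{gamma z}, where
   z^n * kernel is a power series. *)
Lemma zhu_kernelP (g : K) (n : nat) :
  psmul (pspow (fun i => psexp g i - psone K i) n)
        (fun m => zhu_kernel g n (m%:Z - n%:Z)) =
  (fun m => if (n <= m)%N then g ^+ n * psexp g (m - n) else 0).
Proof.
pose s : nat -> K := fun i => g * (i == 1%N)%:R.
have sE f m : psmul s f m = if m is m'.+1 then g * f m' else 0.
  have s1 (i : nat) : i != 1%N -> s i = 0 by rewrite /s => /negbTE->; rewrite mulr0.
  rewrite /psmul; case: m => [|m]; first by rewrite big_ord1 s1 ?mul0r.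
  rewrite !big_ord_recl s1 // mul0r add0r /s /= mulr1 subSS subn0.
  by rewrite big1 ?addr0 // => i _; rewrite mulr0 mul0r.
have -> : (fun i => psexp g i - psone K i) = psmul s (psphi g).
  apply/funext => -[|m]; rewrite sE /psexp /psone /psphi /=.
    by rewrite expr0 fact0 divr1 subrr.
  by rewrite subr0 exprS mulrA.
have -> : (fun m => zhu_kernel g n (m%:Z - n%:Z)) =
          psmul (psexp g) (pspow (psinv (psphi g)) n).
  by apply/funext => m; rewrite /zhu_kernel subrK.
rewrite pspowM -psmulA [psmul (psexp g) _]psmulC (psmulA (pspow (psphi g) n)).
rewrite -pspowM psmulV ?pspow1 ?psmul1; last by rewrite /psphi expr0 divr1.
apply/funext; elim: n => [|n IH] m.
  by rewrite psmul1 leq0n subn0 expr0 mul1r.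
rewrite pspowS -psmulA sE; case: m => // m.
by rewrite IH ltnS subSS; case: ifP => _; rewrite ?mulr0 // exprS mulrA.
Qed.

End KernelTheory.

(* V[gamma], as a module over C[gamma] = {poly C}. *)

Section PolyModule.
Variables (C : fieldType) (V : lmodType C).

Definition fin_supp : {pred nat -> V} :=
  [pred f : nat -> V | `[< exists m : nat, forall i, (m <= i)%N -> f i = 0 >]].

Lemma fin_supp_zmod : zmod_closed fin_supp.
Proof.
split=> [|f g /asboolP[m fm] /asboolP[n gn]]; apply/asboolP; first by exists 0%N.
exists (maxn m n) => i; rewrite geq_max => /andP[mi ni].
by rewrite -[LHS]/(f i - g i) fm ?gn ?subr0.
Qed.

HB.instance Definition _ := GRing.isZmodClosed.Build _ fin_supp fin_supp_zmod.

Record vpoly := VPoly { vcoef :> nat -> V; _ : vcoef \in fin_supp }.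

HB.instance Definition _ := [isSub for vcoef].
HB.instance Definition _ := [Choice of vpoly by <:].
HB.instance Definition _ := [SubChoice_isSubZmodule of vpoly by <:].

Definition vscale_fun (p : {poly C}) (f : vpoly) : nat -> V :=
  fun n => \sum_(i < n.+1) p`_i *: f (n - i)%N.

Lemma vscale_subproof p f : vscale_fun p f \in fin_supp.
Proof.
case: f => f /= fP; have /asboolP[m fm] := fP; apply/asboolP.
exists (size p + m)%N => n le_n; rewrite /vscale_fun big1 // => i _.
have [lt_i|le_i] := ltnP i (size p); last by rewrite nth_default ?scale0r.
by rewrite /= fm ?scaler0 // -(addKn (size p) m) leq_sub // ltnW.
Qed.

Definition vscale p f : vpoly := VPoly (vscale_subproof p f).

Lemma vpolyP (f g : vpoly) : (forall n, f n = g n) -> f = g.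
Proof. by move=> fg; apply/val_inj/funext. Qed.

Lemma vscaleA p q f : vscale p (vscale q f) = vscale (p * q) f.
Proof.
apply: vpolyP => n; rewrite /= /vscale_fun /= /vscale_fun.
transitivity (\sum_(k < n.+1) \sum_(i < n.+1 | (i <= k)%N)
                (p`_i * q`_(k - i)) *: f (n - k)%N); last first.
  apply: eq_bigr => k _; rewrite coefM scaler_suml.
  rewrite (big_ord_widen_cond n.+1 predT (fun i => (p`_i * q`_(k - i)) *: f (n - k)%N)) //.
rewrite (exchange_big_dep predT) //=; apply: eq_bigr => i _.
rewrite -(big_mkord (fun k => (i <= k)%N) (fun k => (p`_i * q`_(k - i)) *: f (n - k)%N)).
have le_in : (i <= n)%N by rewrite -ltnS.
rewrite [RHS](big_cat_nat (n := i)) //=; last exact: ltnW.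
rewrite [X in _ = X + _]big_nat_cond [X in _ = X + _]big1 ?add0r; last first.
  by move=> k /andP[ki ik]; move: ki; rewrite ltnNge ik ?andbF.
transitivity (\sum_(0 + i <= k < n.+1) (p`_i * q`_(k - i)) *: f (n - k)%N).
  rewrite big_addn subSn // big_mkord scaler_sumr.
  by apply: eq_bigr => j _; rewrite scalerA addnK addnC subnDA.
rewrite add0n [RHS]big_nat_cond [LHS]big_nat_cond; apply: eq_bigl => k.
by rewrite andbT; apply/esym/andb_idr => /andP[].
Qed.
Lemma vscale1 : left_id 1 vscale.
Proof.
move=> f; apply: vpolyP => n; rewrite /= /vscale_fun big_ord_recl coef1 scale1r subn0.
by rewrite big1 ?addr0 // => i _; rewrite coef1 scale0r.
Qed.
Lemma vscaleDr : right_distributive vscale +%R.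
Proof.
move=> p f g; apply: vpolyP => n; rewrite -[RHS]/(vscale_fun p f n + vscale_fun p g n).
by rewrite -big_split; apply: eq_bigr => i _; exact: scalerDr.
Qed.
Lemma vscaleDl f : {morph vscale^~ f : p q / p + q}.
Proof.
move=> p q; apply: vpolyP => n; rewrite -[RHS]/(vscale_fun p f n + vscale_fun q f n).
by rewrite -big_split; apply: eq_bigr => i _; rewrite coefD scalerDl.
Qed.

HB.instance Definition _ := GRing.Zmodule_isLmodule.Build {poly C} vpoly
  vscaleA vscale1 vscaleDr vscaleDl.

Lemma vconst_subproof (v : V) : (fun n => if n == 0%N then v else 0) \in fin_supp.
Proof. by apply/asboolP; exists 1%N => -[]. Qed.
Definition vconst (v : V) : vpoly := VPoly (vconst_subproof v).

Lemma vmap_subproof (T : {linear V -> V}) (f : vpoly) : (T \o f) \in fin_supp.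
Proof.
case: f => f /= fP; have /asboolP[m fm] := fP; apply/asboolP.
by exists m => i mi /=; rewrite fm ?linear0.
Qed.
(* The C[gamma]-linear extension of T to V[gamma]. *)
Definition vmap (T : {linear V -> V}) (f : vpoly) : vpoly := VPoly (vmap_subproof T f).

End PolyModule.

Section Quotient.
Variables (K : nzRingType) (M : lmodType K).

Definition lspan (S : set M) : {pred M} :=
  [pred x | `[< exists2 s : seq (K * M), (forall q, q \in s -> S q.2)
                & x = \sum_(q <- s) q.1 *: q.2 >]].

Lemma lspan_submod S : submod_closed (lspan S).
Proof.
split=> [|c x y /asboolP[s Ss ->] /asboolP[t St ->]]; apply/asboolP.
  by exists [::]; rewrite ?big_nil.
exists ([seq (c * q.1, q.2) | q <- s] ++ t) => [q|].
  by rewrite mem_cat => /orP[/mapP[r rs ->]|/St//]; apply: (Ss r).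
rewrite big_cat big_map scaler_sumr; congr (_ + _).
by apply: eq_bigr => q _; rewrite scalerA.
Qed.

HB.instance Definition _ S := GRing.isSubmodClosed.Build K M (lspan S) (lspan_submod S).

Definition lquot (S : set M) := Quotient.quot (lspan S).

HB.instance Definition _ S := GRing.Zmodule.on (lquot S).

Definition cls (S : set M) (x : M) : lquot S := (\pi_(Quotient.quot (lspan S)) x)%qT.

Lemma cls_eq S x y : (cls S x = cls S y) <-> x - y \in lspan S.
Proof.
split=> [/eqmodP|xy]; first by rewrite /= /Quotient.equiv.
by apply/eqmodP; rewrite /= /Quotient.equiv.
Qed.

Lemma cls_repr S (x : lquot S) : cls S (repr x) = x.
Proof. exact: reprK. Qed.

Lemma clsD S x y : cls S (x + y) = cls S x + cls S y.
Proof. exact: (raddfD (\pi_(Quotient.quot (lspan S)))%qT). Qed.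

Definition qscale S (c : K) (x : lquot S) : lquot S := cls S (c *: repr x).

Lemma clsZ S c x : cls S (c *: x) = qscale c (cls S x).
Proof. by apply/cls_eq; rewrite -scalerBr rpredZ //; apply/cls_eq; rewrite cls_repr. Qed.

Lemma qscaleA S c d (x : lquot S) : qscale c (qscale d x) = qscale (c * d) x.
Proof. by rewrite -[x]cls_repr -!clsZ scalerA. Qed.
Lemma qscale1 S : left_id 1 (@qscale S).
Proof. by move=> x; rewrite -[x]cls_repr -clsZ scale1r. Qed.
Lemma qscaleDr S : right_distributive (@qscale S) +%R.
Proof.
by move=> c x y; rewrite -[x]cls_repr -[y]cls_repr -clsD -!clsZ -clsD scalerDr.
Qed.
Lemma qscaleDl S (x : lquot S) : {morph (@qscale S)^~ x : c d / c + d}.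
Proof. by move=> c d; rewrite -[x]cls_repr -!clsZ -clsD scalerDl. Qed.

HB.instance Definition _ S := GRing.Zmodule_isLmodule.Build K (lquot S)
  (@qscaleA S) (@qscale1 S) (@qscaleDr S) (@qscaleDl S).

(* The product and the parity induced on M / Span S by those of M.  The product
   [a][b] = [mul a b] is computed on chosen representatives; the choice is
   immaterial as soon as mul a b \in Span S whenever a or b is in Span S. *)
Definition qmul S (mul : M -> M -> M) (x y : lquot S) : lquot S :=
  cls S (mul (repr x) (repr y)).
Definition qgr S (gr : bool -> set M) (p : bool) : set (lquot S) :=
  (cls S @` gr p)%classic.

End Quotient.

Record odd_differential (K : nzRingType) (A : lmodType K)
    (gr : bool -> set A) (mul : A -> A -> A) (d : A -> A) : Prop := OddDifferential {
  od_linear : linear d;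
  od_odd : forall p x, gr p x -> gr (~~ p) (d x);
  od_leibniz : forall p x y, gr p x ->
    d (mul x y) = mul (d x) y + (-1) ^+ p *: mul x (d y);
  od_square : forall x, d (d x) = 0 }.

Section Zhu.
Variables (C : fieldType) (N : nat) (V : lmodType C) (S : susy_va N V).

(* Res_z of gamma^n e^{gamma z} / (e^{gamma z} - 1)^n a(z, 0, ..., 0) b, as an
   element of a module M over the ring K containing gamma, to which V maps by
   [iota].  The sum is finite since the product is a Laurent series. *)
Definition res_bullet (K : comUnitRingType) (M : lmodType K) (iota : V -> M)
    (g : K) (n : nat) (a b : V) : M :=
  (\sum_(i \in [set: int]%classic)
     zhu_kernel g n i *: iota (field_of (mode S) a (- 1 - i) finset.set0 b)).

Definition bullet (g : C) (n : nat) (a b : V) : V :=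
  if g == 0 then mode S a (- n%:Z) [set: 'I_N] b else res_bullet id g n a b.

Definition zhu_gen (g : C) : set V :=
  [set x | exists n a b, (2 <= n)%N /\ x = bullet g n a b]%classic.

Definition zhu (g : C) : lmodType C := lquot (zhu_gen g).
Definition zhu_cls (g : C) : V -> zhu g := @cls _ _ (zhu_gen g).
Definition zhu_mul (g : C) : zhu g -> zhu g -> zhu g :=
  @qmul _ _ (zhu_gen g) (bullet g 1).
Definition zhu_gr (g : C) : bool -> set (zhu g) := @qgr _ _ (zhu_gen g) (gr S).

(* gamma a formal variable: the operations on V, with values in V[gamma], and
   the C[gamma]-bilinear extension of a bullet_1 b to V[gamma]. *)
Definition fbullet (n : nat) (a b : V) : vpoly V :=
  res_bullet (@vconst C V) ('X : {poly C}) n a b.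

Definition fbullet1 (f h : vpoly V) : vpoly V :=
  (\sum_(i \in [set: nat]%classic) \sum_(j \in [set: nat]%classic)
     ('X^(i + j) : {poly C}) *: fbullet 1 (f i) (h j)).

Definition fgr (p : bool) : set (vpoly V) :=
  [set f | forall n, gr S p (vcoef f n)]%classic.

Definition fzhu_gen : set (vpoly V) :=
  [set x | exists n a b, (2 <= n)%N /\ x = fbullet n a b]%classic.

Definition fzhu : lmodType {poly C} := lquot fzhu_gen.
Definition fzhu_cls : vpoly V -> fzhu := @cls _ _ fzhu_gen.
Definition fzhu_mul : fzhu -> fzhu -> fzhu := @qmul _ _ fzhu_gen fbullet1.
Definition fzhu_gr : bool -> set fzhu := @qgr _ _ fzhu_gen fgr.

End Zhu.

Arguments zhu_mul {C N V} S g.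
Arguments zhu_gr {C N V} S g.
Arguments fzhu_mul {C N V} S.
Arguments fzhu_gr {C N V} S.

(* Main.v *)
From HB Require Import structures.
Require Import Defs.
From mathcomp Require Import all_boot all_order all_algebra.
From mathcomp Require Import zify ring.
From mathcomp Require Import complex.
From mathcomp Require Import reals.
From mathcomp Require Import boolp classical_sets functions cardinality fsbigop.

(* Setting the odd variables to zero turns V into an ordinary vertex
   superalgebra with translation operator D^k o D^k, and the Zhu products only
   see this structure.  Locality and the Goddard argument give the Borcherds
   identity and show that D^k is an odd derivation of all the products
   a(z, 0, ..., 0)b, so D^k preserves the span O of the a *_n b with n >= 2 and
   satisfies the Leibniz rule for *_1; moreover (D^k)^2 a = a *_2 1 lies in O.
   The product on the quotient is computed on representatives, hence one also
   needs that O is a two-sided ideal: the Borcherds identity with m = 0 or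
   k = 0 expresses (a *_n b) *_1 c and a *_1 (b *_n c) through residues of
   products of the kernels f_n = gamma^n e^(gamma z) / (e^(gamma z) - 1)^n, of
   their derivatives and of their reflections, and
     f_n' = - (n - 1) gamma f_n - n f_(n+1),
     f_m f_n = f_(m+n) + gamma f_(m+n-1),
     f_1(z) f_1(-z) = - f_2(z),    f_1(z) f_n(-z) = - f_(n+1)(-z)
   keep these inside the span of the f_n with n >= 2. *)

Set Implicit Arguments.
Unset Strict Implicit.
Unset Printing Implicit Defensive.

Import Order.TTheory GRing.Theory Num.Theory.
Local Open Scope ring_scope.

(** * Finite sums and binomial coefficients *)

(** The axioms only describe brackets with D: their zeta-free part expresses [D, a_i] through the
    modes of the zeta^k component of a(Z), not through the modes of D a. Identifying the two is the
    task of the uniqueness argument: both fields are local with every b, so it is enough to compare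
    them on the vacuum. The Borcherds identity is obtained without delta functions. The difference
    [E m n k] of its two sides obeys a linear recursion that reflects z = w + (z - w). It vanishes
    for k large by locality, and for one value m = M with all n and k, where M comes from the
    locality of a and c only; the recursion then reaches every m, n, k. The kernels are handled as
    the power series z^n f_n with the pole order recorded separately. No identity between them is
    proved by dividing by gamma, so one argument serves gamma nonzero, gamma = 0 and gamma formal.
    Integers are inverted, for exponential series and divided derivatives, whence [charK0]. *)

Definition supp_lt (V : zmodType) (F : nat -> V) (B : nat) : Prop :=
  forall j, (B <= j)%N -> F j = 0.

(** A sum over [[set: nat]] is 0 by convention when the support is infinite, so additivity and
    reindexing are stated under this condition. *)
Definition ffin (V : zmodType) (F : nat -> V) : Prop := exists B, supp_lt F B.

Section FiniteSums.
Variable V : zmodType.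
Implicit Types F G : nat -> V.

Lemma fsum_ltn F B : supp_lt F B ->
  \sum_(j \in [set: nat]) F j = \sum_(j < B) F j.
Proof.
move=> FB; rewrite (@fsbig_ord V 0 +%R B F); apply/esym/fsbig_widen => //.
by move=> j [_ /= /negP]; rewrite -leqNgt => /FB.
Qed.

Lemma fsum_int_ltn (f : int -> V) (s B : nat) :
  (forall i, i < - s%:Z -> f i = 0) -> (forall i, (B%:Z <= i + s%:Z) -> f i = 0) ->
  \sum_(i \in [set: int]) f i = \sum_(j < B) f (j%:Z - s%:Z).
Proof.
move=> fs fB; rewrite (@fsbig_ord V 0 +%R B (fun j => f (j%:Z - s%:Z))).
set h := fun j : nat => j%:Z - s%:Z.
have hI : set_inj `I_B h by move=> i j _ _; rewrite /h => ij; lia.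
rewrite -(fsbig_image _ _ f hI); apply/esym/fsbig_widen => // i [_ /= ni].
have [/fs //|si] := ltP i (- s%:Z).
have [/fB //|Bi] := leP B%:Z (i + s%:Z).
by case: ni; exists (absz (i + s%:Z)) => /=; rewrite /h; lia.
Qed.

Lemma ffinD F G : ffin F -> ffin G -> ffin (fun j => F j + G j).
Proof.
move=> [B FB] [D GD]; exists (maxn B D) => j; rewrite geq_max => /andP[Bj Dj].
by rewrite FB ?GD ?addr0.
Qed.

Lemma ffinS F : ffin F -> ffin (fun j => F j.+1).
Proof. by move=> [B FB]; exists B => j Bj; rewrite FB // ltnW. Qed.

Lemma ffinMz F (z : nat -> int) : ffin F -> ffin (fun j => F j *~ z j).
Proof. by move=> [B FB]; exists B => j /FB ->; rewrite mul0rz. Qed.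

Lemma ffinN F : ffin F -> ffin (fun j => - F j).
Proof. by move=> [B FB]; exists B => j /FB ->; rewrite oppr0. Qed.

Lemma fsumD F G : ffin F -> ffin G ->
  \sum_(j \in [set: nat]) (F j + G j) =
  \sum_(j \in [set: nat]) F j + \sum_(j \in [set: nat]) G j.
Proof.
move=> [B FB] [D GD].
have le1 : supp_lt F (maxn B D) by move=> j; rewrite geq_max => /andP[/FB].
have le2 : supp_lt G (maxn B D) by move=> j; rewrite geq_max => /andP[_ /GD].
rewrite (fsum_ltn le1) (fsum_ltn le2) (@fsum_ltn _ (maxn B D)) ?big_split //.
by move=> j Bj; rewrite le1 ?le2 ?addr0.
Qed.

Lemma fsum0 F : (forall j, F j = 0) -> \sum_(j \in [set: nat]) F j = 0.
Proof. by move=> F0; rewrite fsbig1. Qed.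

Lemma eq_fsum F G : (forall j, F j = G j) ->
  \sum_(j \in [set: nat]) F j = \sum_(j \in [set: nat]) G j.
Proof. by move=> /funext->. Qed.

Lemma fsum_recl F : ffin F ->
  \sum_(j \in [set: nat]) F j = F 0%N + \sum_(j \in [set: nat]) F j.+1.
Proof.
move=> [B FB]; rewrite (@fsum_ltn F B.+1); last by move=> j Bj; rewrite FB // ltnW.
by rewrite (@fsum_ltn (F \o succn) B) ?big_ord_recl // => j Bj /=; rewrite FB // ltnW.
Qed.

End FiniteSums.

Lemma raddf_fsum (U V : zmodType) (f : U -> V) (F : nat -> U) :
  {morph f : x y / x + y} -> ffin F ->
  f (\sum_(j \in [set: nat]) F j) = \sum_(j \in [set: nat]) f (F j).
Proof.
move=> fD [B FB]; have f0 : f 0 = 0 by apply: (@addrI _ (f 0)); rewrite -fD !addr0.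
rewrite (fsum_ltn FB) (@fsum_ltn _ _ B) ?(big_morph f fD f0) //.
by move=> j Bj; rewrite FB.
Qed.

(** As [Negz n] is -(n+1), the second branch is C(-n-1, j) = (-1)^j C(n+j, j): these are the
    coefficients of (1+x)^k for every integer k. *)
Definition binz (k : int) (j : nat) : int :=
  match k with Posz n => 'C(n, j)%:Z | Negz n => (-1) ^+ j * 'C(n + j, j)%:Z end.

Lemma binz0 k : binz k 0 = 1.
Proof. by case: k => n /=; rewrite ?bin0 ?mul1r. Qed.

Lemma binzS k j : binz (k + 1) j.+1 = binz k j.+1 + binz k j.
Proof.
case: k => [n|[|n]].
- by rewrite (_ : n%:Z + 1 = n.+1%:Z); [rewrite /= binS PoszD | lia].
- by rewrite /= !add0n !binn subnn bin0n exprS !mulr1 mulN1r addNr.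
- rewrite (_ : Negz n.+1 + 1 = Negz n); last by lia.
  rewrite /= !addSn !addnS [in RHS]binS exprS PoszD; ring.
Qed.

Lemma binz_absorb k j : binz k j.+1 * j.+1%:Z = (k - j%:Z) * binz k j.
Proof.
case: k => [n|n] /=.
  have [jn|nj] := leqP j n.
    by rewrite subzn // -!PoszM mulnC mul_bin_left.
  by rewrite !bin_small ?mulr0 ?mul0r // ltnW.
have /= e := mul_bin_diag (n + j).+1 j; rewrite addnS.
have {}e : (n + j).+1%:Z * 'C(n + j, j)%:Z = j.+1%:Z * 'C((n + j).+1, j.+1)%:Z by rewrite -!PoszM e.
rewrite -mulrA [X in _ * X]mulrC -e exprS NegzE.
rewrite (_ : (n + j).+1%:Z = n%:Z + j%:Z + 1); last by lia.
by rewrite (_ : n.+1%:Z = n%:Z + 1); [ring | lia].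
Qed.

Lemma binz_nat_small (m j : nat) : (m < j)%N -> binz m j = 0.
Proof. by move=> mj; rewrite /= bin_small. Qed.

(** The identity (1+x)^(k+1) = (1+x)(1+x)^k paired with [G]; the recursions of both sides of the
    Borcherds identity are instances. *)
Lemma fsum_binz_pascal (V : zmodType) (G : nat -> V) k : ffin G ->
  \sum_(j \in [set: nat]) G j *~ binz (k + 1) j =
  \sum_(j \in [set: nat]) (G j + G j.+1) *~ binz k j.
Proof.
move=> Gf; have Gf1 := ffinMz (binz k) Gf; have Gf2 := ffinMz (binz k) (ffinS Gf).
have Gf3 := ffinMz (fun j => binz k j.+1) (ffinS Gf).
rewrite fsum_recl; last exact: ffinMz.
under eq_fsum => j do rewrite binzS mulrzDr.
under [RHS]eq_fsum => j do rewrite mulrzDl.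
by rewrite !fsumD // [in RHS](fsum_recl Gf1) !binz0 addrA.
Qed.

(* Multiplication by (z - w)^M of a two-variable distribution, in mode
   indexing: H i j is the coefficient of z^(-1-i) w^(-1-j). *)
Definition dlt (V : zmodType) M (H : int -> int -> V) i j :=
  \sum_(t < M.+1) H (i + (M - t)%N%:Z) (j + t%:Z) *~ ((-1) ^+ t * 'C(M, t)%:Z).

Section Delta.
Variable V : zmodType.
Implicit Types H G : int -> int -> V.

Lemma dltS M H i j : dlt M.+1 H i j = dlt M H (i + 1) j - dlt M H i (j + 1).
Proof.
rewrite /dlt big_ord_recl [X in _ = X - _]big_ord_recl /= !bin0 !subn0 -!addrA.
congr (_ *~ _ + _).
rewrite [in LHS]big_ord_recr [X in _ = _ - X]big_ord_recr opprD addrA -sumrB /=.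
congr (_ + _); last first.
  rewrite /bump leq0n add1n !binn !subnn exprS !mulr1 mulN1r mulrNz.
  by congr (- (H _ _ *~ _)); lia.
apply: eq_bigr => t _; rewrite /bump /= add1n binS subSS.
have -> : i + 1 + (M - t.+1)%N = i + (M - t)%N by have := ltn_ord t; lia.
have -> : j + 1 + t = j + t.+1%:Z by lia.
rewrite -mulrzBr; congr (_ *~ _); rewrite exprS PoszD; ring.
Qed.

Lemma dlt0 M H i j : (forall i j, H i j = 0) -> dlt M H i j = 0.
Proof. by move=> H0; rewrite /dlt big1 // => t _; rewrite H0 mul0rz. Qed.

Lemma dlt_le M M' H : (M <= M')%N -> (forall i j, dlt M H i j = 0) ->
  forall i j, dlt M' H i j = 0.
Proof.
move=> /subnK <-; elim: (M' - M)%N => [|d IH] H0 i j; first exact: H0.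
by rewrite addSn dltS !IH // subrr.
Qed.

Lemma dltD M H G i j : dlt M (fun i j => H i j + G i j) i j = dlt M H i j + dlt M G i j.
Proof. by rewrite /dlt -big_split; apply: eq_bigr => t _; rewrite mulrzDl. Qed.

Lemma ffin_dlt M (H : nat -> int -> int -> V) i j :
  (forall i j, ffin (fun s => H s i j)) -> ffin (fun s => dlt M (H s) i j).
Proof.
move=> /(_ _ _)/cid/= Hs; pose bd i j := projT1 (Hs i j).
have bdP i' j' := projT2 (Hs i' j').
(* The bound on s varies with the arguments of [H], but only M+1 pairs of arguments occur. *)
pose mx (t : 'I_M.+1) := bd (i + (M - t)%N%:Z) (j + t%:Z).
exists (\max_t mx t)%N => s Bs; rewrite /dlt big1 // => t _.
by rewrite bdP ?mul0rz //; apply: leq_trans Bs; exact: (leq_bigmax (F := mx) t).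
Qed.

Lemma dlt_fsum M (H : nat -> int -> int -> V) i j :
  (forall i j, ffin (fun s => H s i j)) ->
  dlt M (fun i j => \sum_(s \in [set: nat]) H s i j) i j =
  \sum_(s \in [set: nat]) dlt M (H s) i j.
Proof.
move=> /(_ _ _)/cid/= Hs; pose bd i j := projT1 (Hs i j).
have bdP i' j' := projT2 (Hs i' j').
pose mx (t : 'I_M.+1) := bd (i + (M - t)%N%:Z) (j + t%:Z).
pose B := (\max_t mx t)%N.
have HB (t : 'I_M.+1) : supp_lt (fun s => H s (i + (M - t)%N%:Z) (j + t%:Z)) B.
  by move=> s Bs; apply: bdP; apply: leq_trans Bs; exact: (leq_bigmax (F := mx) t).
rewrite (@fsum_ltn _ _ B) => [|s Bs]; last first.
  by rewrite /dlt big1 // => t _; rewrite HB ?mul0rz.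
rewrite /dlt exchange_big; apply: eq_bigr => t _ /=.
by rewrite (fsum_ltn (HB t)) mulrz_suml.
Qed.

Lemma dlt_shift M H r s i j :
  dlt M (fun i j => H (i + r) (j + s)) i j = dlt M H (i + r) (j + s).
Proof. by apply: eq_bigr => t _; congr (H _ _ *~ _); lia. Qed.

Lemma dlt_iter M H i j :
  iter M (fun H i j => H (i + 1) j - H i (j + 1)) H i j = dlt M H i j.
Proof.
elim: M i j => [|M IH] i j; last by rewrite iterS dltS !IH.
by rewrite /dlt big_ord1 /= bin0 !addr0.
Qed.

End Delta.

Lemma raddf_dlt (U V : zmodType) (f : U -> V) M (H : int -> int -> U) i j :
  {morph f : x y / x + y} -> f (dlt M H i j) = dlt M (fun i j => f (H i j)) i j.
Proof.
move=> fD; have f0 : f 0 = 0 by apply: (@addrI _ (f 0)); rewrite -fD !addr0.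
have fN x : f (- x) = - f x by apply: (@addrI _ (f x)); rewrite -fD !subrr.
have fMn x n : f (x *+ n) = f x *+ n by elim: n => // n IH; rewrite !mulrS fD IH.
rewrite /dlt (big_morph f fD f0); apply: eq_bigr => t _.
by case: (_ * _ : int) => n; rewrite -?pmulrn ?NegzE ?mulrNz ?fN fMn.
Qed.

(** * The Borcherds identity *)

(** The Koszul sign is an arbitrary scalar [e], so that products of signs, as for a composite a_i b
    against c, fit without parity bookkeeping. *)
Definition local_modes (C : fieldType) (V : lmodType C) (Y : V -> int -> V -> V)
    (M : nat) (e : C) (a b : V) : Prop :=
  forall i j v, dlt M (fun i j => Y a i (Y b j v) - e *: Y b j (Y a i v)) i j = 0.

Record vertex_superalgebra (C : fieldType) (V : lmodType C) (gr : bool -> set V)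
    (Y : V -> int -> V -> V) (vac : V) (T : V -> V) : Prop := VertexSuperalgebra {
  va_gr : supergrading gr;
  va_linl : forall i b, linear (fun a => Y a i b);
  va_linr : forall a i, linear (Y a i);
  va_even : forall p q a b i, gr p a -> gr q b -> gr (p (+) q) (Y a i b);
  va_trunc : forall a b, exists B : int, forall i, B <= i -> Y a i b = 0;
  va_vac_even : gr false vac;
  va_vac_reg : forall a i, 0 <= i -> Y a i vac = 0;
  va_vac_val : forall a, Y a (- 1) vac = a;
  va_T_lin : linear T;
  va_T_vac : T vac = 0;
  va_T_der : forall a i b, T (Y a i b) = Y a i (T b) - i%:~R *: Y a (i - 1) b;
  va_local : forall p q a b, gr p a -> gr q b ->
    exists M, local_modes Y M ((-1) ^+ (p * q)) a b }.

(* Multiplication by (w - u)^P (z - u)^M of a distribution in z, w, u. *)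
Definition dlt2 (V : zmodType) P M (H : int -> int -> int -> V) m n l :=
  dlt P (fun n l => dlt M (fun m l => H m n l) m l) n l.

Section Delta2.
Variable V : zmodType.
Implicit Types H G : int -> int -> int -> V.

Lemma dlt2C P M H m n l :
  dlt2 P M H m n l = dlt M (fun m l => dlt P (fun n l => H m n l) n l) m l.
Proof.
rewrite /dlt2 /dlt; under eq_bigr => t _ do rewrite mulrz_suml.
under [RHS]eq_bigr => t _ do rewrite mulrz_suml.
rewrite exchange_big; apply: eq_bigr => s _; apply: eq_bigr => t _.
by rewrite -!mulrzA [X in _ *~ X = _]mulrC; congr (H _ _ _ *~ _); lia.
Qed.

Lemma dlt2_kill1 P M H : (forall m n l, dlt M (fun m l => H m n l) m l = 0) ->
  forall m n l, dlt2 P M H m n l = 0.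
Proof. by move=> H0 m n l; apply: dlt0 => i j; exact: H0. Qed.

Lemma dlt2_kill2 P M H : (forall m n l, dlt P (fun n l => H m n l) n l = 0) ->
  forall m n l, dlt2 P M H m n l = 0.
Proof. by move=> H0 m n l; rewrite dlt2C; apply: dlt0 => i j; exact: H0. Qed.

Lemma dlt2D P M H G m n l :
  dlt2 P M (fun m n l => H m n l + G m n l) m n l = dlt2 P M H m n l + dlt2 P M G m n l.
Proof.
rewrite /dlt2 -dltD; congr (dlt _ _ _ _).
by apply/funext => i; apply/funext => j; rewrite -dltD.
Qed.

Lemma dlt2_shift P M H r s m n l :
  dlt2 P M (fun m n l => H (m + r) (n + s) l) m n l = dlt2 P M H (m + r) (n + s) l.
Proof.
apply: eq_bigr => t _; congr (_ *~ _); rewrite (_ : n + _ + s = n + s + (P - t)%N); last by lia.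
by apply: eq_bigr => t' _; congr (H _ _ _ *~ _); lia.
Qed.

Lemma dlt2_fsum P M (H : nat -> int -> int -> int -> V) m n l :
  (forall m n l, ffin (fun s => H s m n l)) ->
  dlt2 P M (fun m n l => \sum_(s \in [set: nat]) H s m n l) m n l =
  \sum_(s \in [set: nat]) dlt2 P M (H s) m n l.
Proof.
move=> Hf; rewrite /dlt2 -dlt_fsum.
  congr (dlt _ _ _ _); apply/funext => i; apply/funext => j.
  by rewrite dlt_fsum.
move=> i j; apply: ffin_dlt => i' j'; exact: Hf.
Qed.

End Delta2.

Lemma raddf_dlt2 (U V : zmodType) (f : U -> V) P M (H : int -> int -> int -> U) m n l :
  {morph f : x y / x + y} ->
  f (dlt2 P M H m n l) = dlt2 P M (fun m n l => f (H m n l)) m n l.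
Proof.
move=> fD; rewrite /dlt2 raddf_dlt //; congr (dlt _ _ _ _).
by apply/funext => i; apply/funext => j; rewrite raddf_dlt.
Qed.

Definition sgnz (k : int) : int := (-1) ^+ absz k.

Lemma sgnzB (k : int) (t : nat) : sgnz (k - t%:Z) = sgnz k * (-1) ^+ t.
Proof.
rewrite /sgnz -exprD -signr_odd -[RHS]signr_odd; congr (_ ^+ nat_of_bool _).
by rewrite oddD; lia.
Qed.

Section Borcherds.
Variables (C : numFieldType) (V : lmodType C) (gr : bool -> set V)
  (Y : V -> int -> V -> V) (vac : V) (T : V -> V).
Hypothesis VA : vertex_superalgebra gr Y vac T.

Implicit Types a b c v : V.

Lemma va_YDl i b : {morph (fun a => Y a i b) : x y / x + y}.
Proof. by move=> x y; have := va_linl VA i b 1 x y; rewrite !scale1r. Qed.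
Lemma va_YDr a i : {morph Y a i : x y / x + y}.
Proof. by move=> x y; have := va_linr VA a i 1 x y; rewrite !scale1r. Qed.
Lemma va_Y0l i b : Y 0 i b = 0.
Proof. by apply: (@addrI _ (Y 0 i b)); rewrite -va_YDl !addr0. Qed.
Lemma va_Y0r a i : Y a i 0 = 0.
Proof. by apply: (@addrI _ (Y a i 0)); rewrite -va_YDr !addr0. Qed.
Lemma va_YZr a i e v : Y a i (e *: v) = e *: Y a i v.
Proof. by have := va_linr VA a i e v 0; rewrite va_Y0r !addr0. Qed.
Lemma va_YZl i b e v : Y (e *: v) i b = e *: Y v i b.
Proof. by have := va_linl VA i b e v 0; rewrite va_Y0l !addr0. Qed.
Lemma va_YNr a i v : Y a i (- v) = - Y a i v.
Proof. by rewrite -scaleN1r va_YZr scaleN1r. Qed.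
Let YDl := va_YDl.
Let YDr := va_YDr.
Let Y0l := va_Y0l.
Let Y0r := va_Y0r.
Let YZr := va_YZr.
Let YNr := va_YNr.
Let YMzr a i v (z : int) : Y a i (v *~ z) = Y a i v *~ z.
Proof. by rewrite -!scaler_int YZr. Qed.
Let TD : {morph T : x y / x + y}.
Proof. by move=> x y; have := va_T_lin VA 1 x y; rewrite !scale1r. Qed.
Let T0 : T 0 = 0. Proof. by apply: (@addrI _ (T 0)); rewrite -TD !addr0. Qed.
Let TZ e v : T (e *: v) = e *: T v.
Proof. by have := va_T_lin VA e v 0; rewrite T0 !addr0. Qed.

Lemma trunc_ffin a b k : ffin (fun j : nat => Y a (k + j%:Z) b).
Proof.
have [B aB] := va_trunc VA a b; exists (absz (B - k)) => j Bj.
by apply: aB; lia.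
Qed.

(* Applied to c, the coefficients of
   Res_(z-w) Y(Y(a, z-w)b, w) i_(w,z-w) z^m w^n (z-w)^k  and
   Res_z Y(a, z)Y(b, w) i_(z,w) z^m w^n (z-w)^k, respectively. *)
Definition borcherdsL a b c m n k : V :=
  \sum_(j \in [set: nat]) Y (Y a (k + j%:Z) b) (m + n - j%:Z) c *~ binz m j.
Definition borcherdsR a b c m n k : V :=
  \sum_(j \in [set: nat]) Y a (m + k - j%:Z) (Y b (n + j%:Z) c) *~ ((-1) ^+ j * binz k j).

Let sgnzS k : sgnz (k + 1) = - sgnz k.
Proof.
rewrite /sgnz; case: k => [n|[|n]] //.
  by rewrite (_ : n%:Z + 1 = n.+1%:Z) ?exprS ?mulN1r //; lia.
rewrite (_ : Negz n.+1 + 1 = Negz n) /=; last by lia.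
by rewrite [in RHS]exprS mulN1r opprK.
Qed.

Let ffinL a b c m n k :
  ffin (fun j : nat => Y (Y a (k + j%:Z) b) (m + n - j%:Z) c).
Proof. by have [B aB] := trunc_ffin a b k; exists B => j /aB ->; rewrite Y0l. Qed.

Let ffinR a b c m n k :
  ffin (fun j : nat => Y a (m + k - j%:Z) (Y b (n + j%:Z) c)).
Proof. by have [B aB] := trunc_ffin b c n; exists B => j /aB ->; rewrite Y0r. Qed.

(** Coefficient form of z^(m+1) w^n (z-w)^k = z^m w^(n+1) (z-w)^k + z^m w^n (z-w)^(k+1), with z^m
    expanded in powers of z - w. *)
Lemma borcherdsL_rec a b c m n k :
  borcherdsL a b c (m + 1) n k = borcherdsL a b c m (n + 1) k + borcherdsL a b c m n (k + 1).
Proof.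
rewrite /borcherdsL fsum_binz_pascal; last exact: ffinL.
rewrite -fsumD; [|exact/ffinMz/ffinL..].
apply: eq_fsum => j; rewrite -mulrzDl; congr ((Y (Y _ _ _) _ _ + Y (Y _ _ _) _ _) *~ _); lia.
Qed.

(** The same monomial identity with (z-w)^k expanded binomially; the sign (-1)^j turns the sum of
    Pascal's rule into a difference. *)
Lemma borcherdsR_rec a b c m n k :
  borcherdsR a b c m n (k + 1) = borcherdsR a b c (m + 1) n k - borcherdsR a b c m (n + 1) k.
Proof.
rewrite /borcherdsR.
under eq_fsum => j do rewrite mulrzA.
rewrite fsum_binz_pascal; last exact/ffinMz/ffinR.
rewrite (raddf_fsum (f := -%R)); [|exact: opprD|exact/ffinMz/ffinR].
rewrite -fsumD; [|exact/ffinMz/ffinR|exact/ffinN/ffinMz/ffinR].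
apply: eq_fsum => j; rewrite exprS mulN1r mulrNz !mulrzA -!mulNrz -!mulrzDl.
have -> : m + (k + 1) - j.+1%:Z = m + k - j%:Z by lia.
have -> : m + (k + 1) - j%:Z = m + 1 + k - j%:Z by lia.
by have -> : n + j.+1%:Z = n + 1 + j%:Z by lia.
Qed.

Lemma borcherdsLD a b m n k :
  {morph (fun c => borcherdsL a b c m n k) : x y / x + y}.
Proof.
move=> x y; rewrite /borcherdsL -fsumD; [|exact/ffinMz/ffinL..].
by apply: eq_fsum => j; rewrite YDr mulrzDl.
Qed.

Lemma borcherdsRD a b m n k :
  {morph (fun c => borcherdsR a b c m n k) : x y / x + y}.
Proof.
move=> x y; rewrite /borcherdsR -fsumD; [|exact/ffinMz/ffinR..].
by apply: eq_fsum => j; rewrite !YDr mulrzDl.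
Qed.

(** Moving c(u) to the left past y(w) and then past x(z) leaves two error terms, the first killed by
    (w-u)^P and the second by (z-u)^M. *)
Lemma comm_modes M P e1 e2 x y c v :
  local_modes Y M e1 x c -> local_modes Y P e2 y c ->
  forall m n l, dlt2 P M (fun m n l =>
    Y x m (Y y n (Y c l v)) - (e1 * e2) *: Y c l (Y x m (Y y n v))) m n l = 0.
Proof.
move=> xc yc m n l.
rewrite (_ : (fun m n l => _) = fun m n l =>
  Y x m (Y y n (Y c l v) - e2 *: Y c l (Y y n v)) +
  e2 *: (Y x m (Y c l (Y y n v)) - e1 *: Y c l (Y x m (Y y n v)))); last first.
  do 3![apply/funext => ?]; rewrite YDr YNr YZr scalerBr scalerA addrA subrK.
  by rewrite mulrC.
rewrite dlt2D dlt2_kill2 ?dlt2_kill1 ?addr0 // => {}m {}n {}l.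
  by rewrite -(@raddf_dlt _ _ ( *:%R e2)) ?xc ?scaler0 //; exact: scalerDr.
by rewrite -(@raddf_dlt _ _ (Y x m)) ?yc ?Y0r.
Qed.

(** Each summand is the expression of [comm_modes] shifted in z and w, and shifts commute with the
    multiplication. Hence M and P do not depend on k, which [E_weak_assoc] relies on for M. *)
Lemma comm_borcherdsR M P e1 e2 x y c v k :
  local_modes Y M e1 x c -> local_modes Y P e2 y c ->
  forall m n l, dlt2 P M (fun m n l =>
    borcherdsR x y (Y c l v) m n k - (e1 * e2) *: Y c l (borcherdsR x y v m n k)) m n l = 0.
Proof.
move=> xc yc m n l.
pose g m n l := Y x m (Y y n (Y c l v)) - (e1 * e2) *: Y c l (Y x m (Y y n v)).
pose z (j : nat) : int := (-1) ^+ j * binz k j.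
pose h j m n l := g (m + (k - j%:Z)) (n + j%:Z) l *~ z j.
have hE m' n' l' j : h j m' n' l' =
    Y x (m' + k - j%:Z) (Y y (n' + j%:Z) (Y c l' v)) *~ z j +
    - ((e1 * e2) *: Y c l' (Y x (m' + k - j%:Z) (Y y (n' + j%:Z) v) *~ z j)).
  rewrite /h /g addrA mulrzBl YMzr -!scaler_int.
  by rewrite !scalerA [_%:~R * _]mulrC.
have f1 m' n' l' := ffinMz z (ffinR x y (Y c l' v) m' n' k).
have f2 m' n' l' : ffin (fun j : nat =>
    - ((e1 * e2) *: Y c l' (Y x (m' + k - j%:Z) (Y y (n' + j%:Z) v) *~ z j))).
  by have [B yB] := trunc_ffin y v n'; exists B => j /yB ->; rewrite Y0r mul0rz Y0r scaler0 oppr0.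
rewrite (_ : (fun m n l => _) = fun m n l => \sum_(j \in [set: nat]) h j m n l); last first.
  apply/funext => m'; apply/funext => n'; apply/funext => l'.
  under eq_fsum => j do rewrite hE.
  rewrite fsumD // /borcherdsR; congr (_ + _).
  rewrite (@raddf_fsum _ _ (Y c l')) // -?scaleNr; last exact/ffinMz/ffinR.
  rewrite (@raddf_fsum _ _ ( *:%R (- (e1 * e2)))); [|exact: scalerDr|].
    by apply: eq_fsum => j; rewrite scaleNr.
  by have [B yB] := trunc_ffin y v n'; exists B => j /yB ->; rewrite Y0r mul0rz Y0r.
rewrite dlt2_fsum => [|m' n' l']; last by rewrite (funext (hE m' n' l')); apply: ffinD.
apply: fsum0 => j; rewrite /h.
rewrite -(@raddf_dlt2 _ _ ( *~%R^~ (z j))); last by move=> ? ?; rewrite mulrzDl.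
by rewrite (dlt2_shift _ _ g) (comm_modes _ xc yc) mul0rz.
Qed.

Section Homogeneous.
Variables (p q : bool) (a b : V).
Hypotheses (pa : gr p a) (qb : gr q b).

Let e : C := (-1) ^+ (p * q).

(** The defect of the Borcherds identity. The last term expands (z-w)^k = (-1)^k (w-z)^k in the
    opposite region, whence [sgnz k]. *)
Let E m n k c : V := borcherdsL a b c m n k -
  (borcherdsR a b c m n k - e *: borcherdsR b a c n m k *~ sgnz k).

Let ED m n k : {morph E m n k : x y / x + y}.
Proof.
move=> x y; rewrite /E borcherdsLD !borcherdsRD scalerDr mulrzDl [- (_ *~ _ + _)]opprD.
by rewrite [X in _ + _ - X]addrACA opprD addrACA.
Qed.

Let E_rec m n k c : E (m + 1) n k c = E m (n + 1) k c + E m n (k + 1) c.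
Proof.
rewrite /E borcherdsL_rec !borcherdsR_rec sgnzS mulrNz opprK scalerBr mulrzBl.
rewrite [RHS]addrACA -opprD; congr (_ + _ - _).
by rewrite addrCA [X in _ = _ + X]addrA subrK addrA subrK.
Qed.

Lemma borcherdsR_nat x y c m n (k : nat) : borcherdsR x y c m n k =
  \sum_(j < k.+1) Y x (m + (k - j)%N%:Z) (Y y (n + j%:Z) c) *~ ((-1) ^+ j * 'C(k, j)%:Z).
Proof.
rewrite /borcherdsR (@fsum_ltn _ _ k.+1).
  by apply: eq_bigr => j _; congr (Y _ _ _ *~ _); have := ltn_ord j; lia.
by move=> j kj; rewrite binz_nat_small // mulr0 mulr0z.
Qed.

(** For k large every a_(k+j) b vanishes, and the right side is a coefficient of (z-w)^k
    [a(z), b(w)], zero by locality. *)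
Let E_large : exists K : nat, forall k, K%:Z <= k -> forall m n c, E m n k c = 0.
Proof.
have [M abM] := va_local VA pa qb; have [B aB] := va_trunc VA a b.
exists (maxn M (absz B)) => -[k|k] Kk m n c; last by lia.
rewrite /E {1}/borcherdsL fsum0 ?sub0r; last by move=> j; rewrite aB ?Y0l ?mul0rz //; lia.
apply/eqP; rewrite oppr_eq0; apply/eqP.
have := dlt_le _ (fun i j => abM i j c) m n => /(_ k) <-; last by lia.
(* The second sum expands (w-z)^k; reversing its index aligns it with (z-w)^k. *)
rewrite !borcherdsR_nat [X in _ - (_ *: X) *~ _](reindex_inj rev_ord_inj) /=.
rewrite scaler_sumr mulrz_suml -sumrB; apply: eq_bigr => j _.
have jk : (j <= k)%N by rewrite -ltnS.
rewrite subSS subKn // bin_sub // mulrzBl; congr (_ - _).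
rewrite -!scaler_int !scalerA; congr (_ *: _).
rewrite /sgnz /= !rmorphM /= !rmorphXn /= !rmorphN1.
have -> : (-1) ^+ k = (-1) ^+ (k - j) * (-1) ^+ j :> C by rewrite -exprD subnK.
set x := (-1) ^+ (k - j); set y := (-1) ^+ j.
have xx : x * x = 1 by rewrite -expr2 sqrr_sign.
transitivity (x * x * (y * 'C(k, j)%:~R * e)); first by rewrite /e; ring.
by rewrite xx mul1r.
Qed.

(** On the vacuum T acts as d/dz + d/dw, which annihilates (z-w)^k; for m = 0, integration by parts
    then differentiates only w^n. *)
Let T_borcherdsR n k :
  T (borcherdsR a b vac 0 n k) = - (borcherdsR a b vac 0 (n - 1) k *~ n).
Proof.
rewrite /borcherdsR raddf_fsum //; last exact/ffinMz/ffinR.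
pose A j := Y a (k - j%:Z) (Y b (n - 1 + j%:Z) vac).
have Af : ffin A by have := ffinR a b vac 0 (n - 1) k; rewrite add0r.
(* [F j.+1] comes from differentiating a(z). Since [F 0] is 0, its sum can be reindexed and merged
   with the terms from b(w). *)
pose F j := A j *~ ((-1) ^+ j * binz k j * j%:Z).
have Ff : ffin F by exact: ffinMz.
transitivity (\sum_(j \in [set: nat])
  (A j *~ ((-1) ^+ j * binz k j * - (n + j%:Z)) + F j.+1)).
  apply: eq_fsum => j; rewrite -!scaler_int TZ (va_T_der VA) (va_T_der VA).
  rewrite (va_T_vac VA) Y0r sub0r add0r YNr YZr -scaleNr scalerBr !scalerA /F /A -!scaler_int.
  congr (_ *: Y _ _ (Y _ _ _) + _).
  - by rewrite -[in LHS]rmorphN -rmorphM.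
  - by lia.
  rewrite -scaleNr; congr (_ *: Y _ _ (Y _ _ _)); try by lia.
  by rewrite -rmorphM -rmorphN; congr (_%:~R); rewrite -mulrA binz_absorb exprS; ring.
rewrite fsumD; [|exact: ffinMz|exact: ffinS].
have -> : \sum_(j \in [set: nat]) F j.+1 = \sum_(j \in [set: nat]) F j.
  by rewrite [RHS]fsum_recl // /F mulr0 mulr0z add0r.
rewrite -fsumD; [|exact: ffinMz|exact: Ff].
rewrite -mulrNz (raddf_fsum (f := fun x => x *~ - n)); first last.
- by have := ffinR a b vac 0 (n - 1) k; exact: ffinMz.
- by move=> x y; rewrite mulrzDl.
apply: eq_fsum => j; rewrite /F /A -mulrzDr -mulrzA add0r; congr (_ *~ _); ring.
Qed.

Let mulrz_eq0C v (z : int) : z != 0 -> v *~ z = 0 -> v = 0.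
Proof.
by move=> z0 /eqP; rewrite -scaler_int scaler_eq0 intr_eq0 (negbTE z0) => /eqP.
Qed.

(** [E_rec] lowers m to 0, where the term with b outside drops out on the vacuum and the left side
    is (a_k b)_n vac. The two remaining sides vanish for n >= 0, equal a_k b at n = -1, and T sends
    each to -n times its value at n - 1, which settles n < -1. *)
Let E_vac m n k : 0 <= m -> E m n k vac = 0.
Proof.
case: m => // m _; elim: m n k => [|m IH] n k; last first.
  by rewrite (_ : m.+1%:Z = m%:Z + 1) ?E_rec ?IH ?addr0 //; lia.
rewrite /E [borcherdsR b a _ _ _ _]/borcherdsR [X in _ *: X]fsum0 ?scaler0 ?mul0rz ?subr0; last first.
  by move=> j; rewrite (va_vac_reg VA) ?Y0r ?mul0rz.
have -> n' : borcherdsL a b vac 0 n' k = Y (Y a k b) n' vac.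
  rewrite /borcherdsL fsum_recl; last exact/ffinMz/ffinL.
  rewrite fsum0 ?addr0; last by move=> j; rewrite binz_nat_small ?mulr0z.
  by rewrite binz0 mulr1z; congr (Y (Y _ _ _) _ _); lia.
have [n0|] := leP 0 n.
  rewrite (va_vac_reg VA) // /borcherdsR fsum0 ?subrr // => j.
  by rewrite (va_vac_reg VA) ?Y0r ?mul0rz //; lia.
case: n => // n _; elim: n => [|n IH].
  rewrite (va_vac_val VA) /borcherdsR fsum_recl; last exact/ffinMz/ffinR.
  rewrite fsum0 => [|j]; last by rewrite (va_vac_reg VA) ?Y0r ?mul0rz //; lia.
  rewrite binz0 addr0 (_ : -1 + 0%:Z = -1) // (va_vac_val VA) mulr1z.
  by rewrite (_ : 0%:Z + k - 0%:Z = k) ?subrr //; lia.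
apply: (@mulrz_eq0C _ (Negz n)) => //; rewrite mulrzBl.
have en : Negz n - 1 = Negz n.+1 by lia.
have := T_borcherdsR (Negz n) k; rewrite en => /esym/(canRL opprK) ->.
have := va_T_der VA (Y a k b) (Negz n) vac.
rewrite (va_T_vac VA) Y0r sub0r en scaler_int => /esym/(canRL opprK) ->.
by move/eqP: IH; rewrite subr_eq0 => /eqP ->; rewrite subrr.
Qed.

Section ThirdField.
Variables (r : bool) (c : V).
Hypothesis rc : gr r c.

Let ec : C := (-1) ^+ (p * r) * (-1) ^+ (q * r).

(** All the composites a_(k+j) b sit at w, so a power of w - u is enough. Finitely many are nonzero,
    so one exponent works; it may depend on k. *)
Let comm_borcherdsL k v : exists P, forall m n l, dlt P (fun n l =>
  borcherdsL a b (Y c l v) m n k - ec *: Y c l (borcherdsL a b v m n k)) n l = 0.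
Proof.
have [J abJ] := trunc_ffin a b k.
have [P locP] : exists P, forall j, (j < J)%N -> local_modes Y P ec (Y a (k + j%:Z) b) c.
  elim: (J) => [|J' [P hP]]; first by exists 0%N.
  have [P' hP'] := va_local VA (va_even VA (k + J'%:Z) pa qb) rc.
  exists (maxn P P') => j; rewrite ltnS leq_eqVlt => /orP[/eqP ->|jJ'] i i' w.
    have -> : ec = (-1) ^+ ((p (+) q) * r).
      by rewrite /ec; case: (p) (q) (r) => [] [] []; rewrite /= ?mulr1 ?mul1r ?mulrN1 ?opprK.
    by apply: (dlt_le (leq_maxr P P')) => i1 i2; apply: hP'.
  by apply: (dlt_le (leq_maxl P P')) => i1 i2; apply: hP.
exists P => m n l.
pose g j n l := Y (Y a (k + j%:Z) b) n (Y c l v) - ec *: Y c l (Y (Y a (k + j%:Z) b) n v).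
rewrite (_ : (fun n l => _) =
    fun n l => \sum_(j < J) g j (n + (m - j%:Z)) l *~ binz m j); last first.
  apply/funext => n'; apply/funext => l'; rewrite /borcherdsL.
  rewrite !(@fsum_ltn _ _ J); try by move=> j /abJ ->; rewrite Y0l mul0rz.
  rewrite (big_morph (Y c l') (YDr c l') (Y0r c l')) scaler_sumr -sumrB.
  apply: eq_bigr => j _; rewrite YMzr /g mulrzBl -!scaler_int !scalerA [_ * ec]mulrC.
  by rewrite (_ : m + n' - j%:Z = n' + (m - j%:Z)); last by lia.
rewrite /dlt; under eq_bigr do rewrite mulrz_suml; rewrite exchange_big big1 // => j _ /=.
under eq_bigr => t _ do rewrite -mulrzA mulrC mulrzA.
rewrite -mulrz_suml -/(dlt P (fun n l => g j (n + (m - j%:Z)) l) n l).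
have := dlt_shift P (g j) (m - j%:Z) 0 n l.
rewrite (_ : (fun i i' => _) = fun i i' => g j (i + (m - j%:Z)) i'); last first.
  by do 2![apply/funext => ?]; rewrite addr0.
by move=> ->; rewrite locP ?mul0rz.
Qed.

(* [E m n k, c(u)] is killed by (z-u)^M (w-u)^P with M independent of k; on the
   vacuum, the u^0 term of this product is E (m + M) (n + P) k c. *)
Let E_weak_assoc : exists M : nat, forall n k, E M n k c = 0.
Proof.
have [M acM] := va_local VA pa rc; have [P0 bcP] := va_local VA qb rc.
exists M => n k; have [P1 LP] := comm_borcherdsL k vac.
pose P := maxn P0 P1.
have {}bcP : local_modes Y P ((-1) ^+ (q * r)) b c.
  by move=> i j v; apply: (dlt_le (leq_maxl P0 P1)) => i1 i2; apply: bcP.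
have {}LP m := dlt_le (leq_maxr P0 P1) (LP m).
have RP : forall m n l, dlt2 P M (fun m n l => borcherdsR a b (Y c l vac) m n k -
    ec *: Y c l (borcherdsR a b vac m n k)) m n l = 0.
  exact: (comm_borcherdsR vac k acM bcP).
have RP' : forall m n l, dlt2 P M (fun m n l => borcherdsR b a (Y c l vac) n m k -
    ec *: Y c l (borcherdsR b a vac n m k)) m n l = 0.
  move=> m n' l; rewrite dlt2C /ec [_ * (-1) ^+ (q * r)]mulrC.
  exact: (comm_borcherdsR vac k bcP acM).
pose H m n l := E m n k (Y c l vac) - ec *: Y c l (E m n k vac).
have H0 m n' l : dlt2 P M H m n' l = 0.
  rewrite (_ : H = fun m n l =>
      (borcherdsL a b (Y c l vac) m n k - ec *: Y c l (borcherdsL a b vac m n k)) +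
      (- (borcherdsR a b (Y c l vac) m n k - ec *: Y c l (borcherdsR a b vac m n k)) +
      (e * (sgnz k)%:~R) *: (borcherdsR b a (Y c l vac) n m k -
        ec *: Y c l (borcherdsR b a vac n m k)))); last first.
    do 3![apply/funext => ?]; rewrite /H /E.
    rewrite !(YDr, YNr, YZr, YMzr) -!scaler_int !(scalerDr, scalerN) !scalerA.
    rewrite !opprD !opprK !addrA [RHS](ACl (1*3*5*2*4*6)%AC) /=.
    by congr (_ + _ *: _ + _ + _ - _ *: _); ring.
  rewrite dlt2D dlt2_kill2 // add0r dlt2D.
  rewrite -(@raddf_dlt2 _ _ -%R); last exact: opprD.
  rewrite -(@raddf_dlt2 _ _ ( *:%R (e * (sgnz k)%:~R))); last exact: scalerDr.
  by rewrite RP RP' oppr0 scaler0 !addr0.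
have E0 m n' : E m n' k 0 = 0.
  by apply: (@addrI _ (E m n' k 0)); rewrite -ED !addr0.
have HE (m : nat) n' l : 0 <= l -> H m n' l = 0.
  by move=> l0; rewrite /H E_vac // (va_vac_reg VA) // Y0r E0 scaler0 subrr.
have := H0 0 (n - P%:Z) (-1); rewrite /dlt2 /dlt big_ord_recl [X in _ + X]big1; last first.
  by move=> t _; rewrite big1 ?mul0rz // => s _; rewrite add0r HE ?mul0rz //.
rewrite addr0 big_ord_recl [X in (_ + X) *~ _]big1; last first.
  by move=> s _; rewrite add0r HE ?mul0rz // /= /bump leq0n; lia.
rewrite /= !bin0 !mulr1z !addr0 !subn0 add0r subrK.
by rewrite /H E_vac // Y0r scaler0 subr0 (va_vac_val VA).
Qed.

(* The defect E vanishes for m = M and for k large; the recursion E_rec spreads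
   this to all m and k. *)
Lemma borcherds_homogeneous m n k : borcherdsL a b c m n k =
  borcherdsR a b c m n k - (-1) ^+ (p * q) *: borcherdsR b a c n m k *~ sgnz k.
Proof.
apply/eqP; rewrite -subr_eq0; apply/eqP; rewrite -/(E m n k c).
have [M EM] := E_weak_assoc; have [K EK] := E_large.
have up (d : nat) n' k' : E (M%:Z + d%:Z) n' k' c = 0.
  elim: d n' k' => [|d IH] n' k'; first by rewrite addr0 EM.
  by rewrite (_ : M%:Z + d.+1%:Z = M%:Z + d%:Z + 1) ?E_rec ?IH ?addr0 //; lia.
have down (d : nat) n' k' : E (M%:Z - d%:Z) n' k' c = 0.
  elim: d n' k' => [|d IH] n' k'; first by rewrite subr0 EM.
  (* At the next smaller m, [E_rec] trades k' for k' + 1 modulo a defect already known to vanish;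
     [s] steps reach the range of [E_large]. *)
  have [s] : exists s : nat, K%:Z <= k' + s%:Z by exists (absz (K%:Z - k')); lia.
  elim: s n' k' => [|s IHs] n' k' Ks; first by rewrite EK //; lia.
  have := E_rec (M%:Z - d.+1%:Z) (n' - 1) k' c.
  rewrite (_ : M%:Z - d.+1%:Z + 1 = M%:Z - d%:Z); last by lia.
  by rewrite IH subrK (IHs _ (k' + 1)) ?addr0 => [<-|] //; lia.
have [Mm|mM] := leP M%:Z m.
  by rewrite (_ : m = M%:Z + (absz (m - M%:Z))%:Z) ?up //; lia.
by rewrite (_ : m = M%:Z - (absz (M%:Z - m))%:Z) ?down //; lia.
Qed.

End ThirdField.

Theorem borcherds_identity c m n k : borcherdsL a b c m n k =
  borcherdsR a b c m n k - (-1) ^+ (p * q) *: borcherdsR b a c n m k *~ sgnz k.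
Proof.
have [c0 [c1 [g0 g1 ->]]] := gr_split (va_gr VA) c.
rewrite borcherdsLD !borcherdsRD (borcherds_homogeneous g0) (borcherds_homogeneous g1).
by rewrite scalerDr mulrzDl [- (_ *~ _ + _)]opprD [LHS]addrACA.
Qed.

End Homogeneous.
End Borcherds.

(** * The kernels as power series *)

(** An alias of the function type, so that the ring product can be the Cauchy product and [ring]
    applies to power series. *)
Definition pseries (K : comUnitRingType) : Type := nat -> K.

HB.instance Definition _ (K : comUnitRingType) :=
  GRing.Zmodule.copy (pseries K) (nat -> K).

Section PowerSeriesRing.
Variable K : comUnitRingType.
Implicit Types F G : pseries K.

Let mul : pseries K -> pseries K -> pseries K := @psmul K.

Lemma pseries_mulDl : left_distributive mul +%R.
Proof.
move=> F G H; apply/funext => n; rewrite -[RHS]/(mul F H n + mul G H n) -big_split.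
by apply: eq_bigr => i _; exact: mulrDl.
Qed.

Lemma pseries_one_neq0 : (@psone K : pseries K) != 0.
Proof.
apply/eqP => /(congr1 (fun F : pseries K => F 0%N)) /eqP.
by rewrite -[X in _ == X]/(0 : K) /psone oner_eq0.
Qed.

HB.instance Definition _ := GRing.Zmodule_isComNzRing.Build (pseries K)
  (@psmulA K : associative mul) (@psmulC K : commutative mul)
  (@psmul1 K : left_id _ mul) pseries_mulDl pseries_one_neq0.

Lemma pseriesME F G n : (F * G) n = \sum_(i < n.+1) F i * G (n - i)%N.
Proof. by []. Qed.

Lemma pseries1E n : (1 : pseries K) n = (n == 0%N)%:R.
Proof. by []. Qed.

Lemma pspowE F n : pspow F n = F ^+ n.
Proof. by elim: n => // n IH; rewrite pspowS IH exprS. Qed.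

(** The operator z d/dz: unlike d/dz it keeps degrees, so pole orders can be tracked apart. Its
    companion [psrefl] substitutes -z for z. *)
Definition pstheta F : pseries K := fun i => i%:R * F i.
Definition psrefl F : pseries K := fun i => (-1) ^+ i * F i.

Lemma pstheta_mul F G : pstheta (F * G) = pstheta F * G + F * pstheta G.
Proof.
apply/funext => n; rewrite -[RHS]/((pstheta F * G) n + (F * pstheta G) n).
rewrite /pstheta !pseriesME mulr_sumr -big_split; apply: eq_bigr => i _ /=.
rewrite -{1}(subnK (leq_ord i)) natrD; ring.
Qed.

Lemma pstheta_exp F n : pstheta (F ^+ n.+1) = (F ^+ n * pstheta F) *+ n.+1.
Proof.
elim: n => [|n IH]; first by rewrite expr1 expr0 mul1r.
rewrite exprS pstheta_mul IH [RHS]mulrS; rewrite exprS -mulrnAr; ring.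
Qed.

Lemma psrefl_mul F G : psrefl (F * G) = psrefl F * psrefl G.
Proof.
apply/funext => n; rewrite /psrefl !pseriesME mulr_sumr; apply: eq_bigr => i _ /=.
rewrite -{1}(subnK (leq_ord i)) exprD; ring.
Qed.

Lemma psrefl1 : psrefl 1 = 1.
Proof.
apply/funext => -[|n]; rewrite /psrefl pseries1E ?mul1r //.
by rewrite mulr0.
Qed.

Lemma psrefl_exp F n : psrefl (F ^+ n) = psrefl F ^+ n.
Proof. by elim: n => [|n IH]; [exact: psrefl1 | rewrite !exprS psrefl_mul IH]. Qed.

Definition psX : pseries K := fun i => (i == 1%N)%:R.

Lemma psXM F n : (psX * F) n = if n is m.+1 then F m else 0.
Proof.
rewrite pseriesME; case: n => [|n]; first by rewrite big_ord1 mul0r.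
rewrite !big_ord_recl mul0r add0r mul1r subSS subn0.
by rewrite big1 ?addr0 // => i _; rewrite /psX /= mul0r.
Qed.

End PowerSeriesRing.

Section KernelSeries.
Variables (K : comUnitRingType) (g : K).
Hypothesis charK0 : forall n, n.+1%:R \is a @GRing.unit K.

Definition psgz : pseries K := fun i => g * psX K i.

Lemma psgzM F n : (psgz * F) n = if n is m.+1 then g * F m else 0.
Proof.
rewrite -[LHS]/(\sum_(i < n.+1) g * psX K i * F (n - i)%N).
under eq_bigr do rewrite -mulrA.
by rewrite -mulr_sumr -pseriesME psXM; case: n => //; rewrite mulr0.
Qed.

(** With x = gamma z, [E], [phi] and [P] are e^x, (e^x - 1)/x and x/(e^x - 1). With the factor x
    removed, [phi] is invertible whether or not gamma is. *)
Let E : pseries K := psexp g.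
Let phi : pseries K := psphi g.
Let P : pseries K := psinv phi.

Lemma factK_unit n : n`!%:R \is a @GRing.unit K.
Proof. by elim: n => [|n IH]; rewrite ?fact0 ?unitr1 // factS natrM unitrM charK0. Qed.

Lemma psphiV : phi * P = 1.
Proof. by apply: psmulV; rewrite /phi /psphi expr0 divr1. Qed.

Lemma psexpE : E = 1 + psgz * phi.
Proof.
apply/funext => n; rewrite -[RHS]/(psone K n + (psgz * phi) n) psgzM /E /psexp /psone.
by case: n => [|n] /=; rewrite ?addr0 ?add0r ?fact0 ?expr0 ?divr1 // exprS mulrA.
Qed.

(** The relation behind the formula for f_m f_n and behind the reduction of powers of [E] in
    [zres_refl]. *)
Lemma psexpMinv : E * P = P + psgz.
Proof. by rewrite psexpE mulrDl mul1r -mulrA psphiV mulr1. Qed.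

Lemma pstheta_exp_series : pstheta E = psgz * E.
Proof.
apply/funext => n; rewrite psgzM /pstheta /E /psexp; case: n => [|n]; first by rewrite mul0r.
rewrite factS natrM invrM ?charK0 ?factK_unit // exprS.
set u := n.+1%:R; set v := n`!%:R^-1.
transitivity (u * u^-1 * (g * (g ^+ n * v))); first by ring.
by rewrite mulrV ?mul1r ?charK0.
Qed.

(** Differentiating gamma z phi = e^(gamma z) - 1 yields this only up to the factor gamma z, so
    coefficients are compared instead: gamma may be 0. *)
Lemma pstheta_phi : pstheta phi = E - phi.
Proof.
apply/funext => n; rewrite -[RHS]/(E n - phi n) /pstheta /phi /E /psphi /psexp.
rewrite factS natrM invrM ?charK0 ?factK_unit //.
have -> : n%:R = n.+1%:R - 1 :> K by rewrite -natr1 addrK.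
set u := n.+1%:R; set v := n`!%:R^-1.
transitivity (u * u^-1 * (g ^+ n * v) - g ^+ n * (v * u^-1)); first by ring.
by rewrite mulrV ?mul1r ?charK0.
Qed.

Lemma pstheta_inv : pstheta P = P - E * P ^+ 2.
Proof.
have h : pstheta P * phi = - (P * (E - phi)).
  apply/eqP; rewrite -addr_eq0 -pstheta_phi -pstheta_mul mulrC psphiV.
  apply/eqP/funext => -[|n]; rewrite /pstheta ?mul0r //.
  by rewrite pseries1E mulr0.
rewrite -[LHS]mulr1 -psphiV mulrA h.
transitivity (P * (phi * P) - E * P ^+ 2); first by ring.
by rewrite psphiV mulr1.
Qed.

(** That is, e^x (1 - e^(-x))/x = (e^x - 1)/x. In degree n it amounts to (-1 + 1)^(n+1) = 0 expanded
    binomially and solved for its last term. *)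
Lemma psexpM_refl_phi : E * psrefl phi = phi.
Proof.
apply/funext => n; rewrite pseriesME /psrefl /phi /E /psexp /psphi.
transitivity (\sum_(i < n.+1)
    - ((-1) ^+ (n.+1 - i) * 1 ^+ i *+ 'C(n.+1, i)) * (g ^+ n / n.+1`!%:R)).
  apply: eq_bigr => i _; have le_in := leq_ord i.
  have -> : g ^+ n = g ^+ i * g ^+ (n - i) by rewrite -exprD subnKC.
  have h : 'C(n.+1, i)%:R * (i`!%:R * (n - i).+1`!%:R) = n.+1`!%:R :> K.
    by rewrite -!natrM -subSn // bin_fact // ltnW.
  have := factK_unit n.+1; rewrite -{1}h !unitrM => /and3P[uC ui un].
  rewrite -h !invrM ?unitrM ?uC ?ui ?un // expr1n mulr1 -mulr_natr subSn // exprS.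
  rewrite -[LHS](mulrVK uC); ring.
rewrite -mulr_suml sumrN.
have := exprDn (-1 : K) 1 n.+1; rewrite addNr expr0n big_ord_recr /=.
rewrite subnn binn expr0 expr1n mulr1 => /esym/eqP; rewrite addr_eq0 => /eqP ->.
by rewrite opprK mul1r.
Qed.

Lemma psrefl_inv : psrefl P = E * P.
Proof.
have h : psrefl phi * psrefl P = 1 by rewrite -psrefl_mul psphiV psrefl1.
rewrite -[RHS]mulr1 -h; transitivity ((E * psrefl phi) * P * psrefl P); last by ring.
by rewrite psexpM_refl_phi psphiV mul1r.
Qed.

Lemma psexpM_refl : E * psrefl E = 1.
Proof.
have -> : psrefl E = 1 - psgz * psrefl phi.
  rewrite psexpE; apply/funext => n.
  rewrite -[RHS]/((1 : pseries K) n - (psgz * psrefl phi) n) psgzM /psrefl.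
  rewrite -[X in _ * X]/((1 : pseries K) n + (psgz * phi) n) psgzM mulrDr.
  congr (_ + _); last by case: n => [|n]; rewrite ?mulr0 ?oppr0 // exprS; ring.
  exact: (congr1 (fun F : pseries K => F n) (psrefl1 K)).
rewrite mulrBr mulr1 mulrCA psexpM_refl_phi {1}psexpE; ring.
Qed.

(** The kernel f_n without its pole, that is z^n f_n. *)
Definition zhu_series n : pseries K := E * P ^+ n.

Lemma zhu_kernelE n i :
  zhu_kernel g n i = if i + n%:Z is Posz m then zhu_series n m else 0.
Proof. by rewrite /zhu_kernel; case: (i + n%:Z) => // m; rewrite pspowE. Qed.

Lemma zhu_seriesM m n : zhu_series m * zhu_series n.+1 =
  zhu_series (m + n.+1) + psgz * zhu_series (m + n).
Proof.
rewrite /zhu_series addnS !exprS !exprD.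
transitivity (E * P ^+ m * P ^+ n * (E * P)); first by ring.
rewrite psexpMinv; ring.
Qed.

(** As (z^(-s) F)' = z^(-s-1) (z F' - s F), this is the formula for the derivative of f_(n+1),
    multiplied by z^(n+2). *)
Lemma pstheta_zhu_series n : pstheta (zhu_series n.+1) - zhu_series n.+1 *+ n.+1 =
  - (psgz * zhu_series n.+1 *+ n) - zhu_series n.+2 *+ n.+1.
Proof.
rewrite /zhu_series pstheta_mul pstheta_exp pstheta_exp_series pstheta_inv.
have -> : E * (P ^+ n * (P - E * P ^+ 2) *+ n.+1) =
    (E * P ^+ n.+1 - E * P ^+ n.+1 * (E * P)) *+ n.+1.
  by rewrite mulrnAr [P ^+ n.+1]exprS; congr (_ *+ _); ring.
rewrite psexpMinv [P ^+ n.+2]exprS mulrS; ring.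
Qed.

Lemma zhu_series2_coef0 : zhu_series 2 0%N = 1.
Proof.
have P0 : P 0%N = 1.
  have := congr1 (fun F : pseries K => F 0%N) psphiV.
  by rewrite pseriesME big_ord1 pseries1E /phi /psphi expr0 divr1 mul1r.
rewrite /zhu_series pseriesME big_ord1 /E /psexp expr0 fact0 divr1 mul1r.
by rewrite expr2 pseriesME big_ord1 P0 mulr1.
Qed.

(** The residue of f_2 vanishes because f_2 = - f_1' is a derivative. *)
Lemma zhu_series2_coef1 : zhu_series 2 1%N = 0.
Proof.
have e := congr1 (fun F : pseries K => F 1%N) (pstheta_zhu_series 0).
rewrite mulr0n oppr0 add0r !mulr1n in e.
apply: oppr_inj; rewrite oppr0 -[LHS]/((- zhu_series 2 : pseries K) 1%N) -e.
by rewrite -[LHS]/(1%:R * zhu_series 1 1%N - zhu_series 1 1%N) mul1r subrr.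
Qed.

(** The right side is z^(n+2) f_(n+2)(-z) up to sign, written with positive powers of [E] so that it
    can be reduced by [psexpMinv]. *)
Lemma zhu_series1_refl n :
  zhu_series 1 * psrefl (zhu_series n.+1) = E ^+ n.+1 * P ^+ n.+2.
Proof.
rewrite /zhu_series psrefl_mul psrefl_exp psrefl_inv exprMn expr1.
transitivity ((E * psrefl E) * E ^+ n.+1 * P ^+ n.+2); first by rewrite !exprS; ring.
by rewrite psexpM_refl mul1r.
Qed.

End KernelSeries.

(** * Residue pairings *)

Definition ubounded (M : zmodType) (x : int -> M) : Prop :=
  exists B : int, forall i, B <= i -> x i = 0.

(* Zero outside of a bounded region of each quadrant i >= s, j >= t. *)
Definition quadrant_finite (M : zmodType) (x : int -> int -> M) : Prop :=
  forall s t : int, exists B : int, forall i j, s <= i -> t <= j ->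
    (B <= i) || (B <= j) -> x i j = 0.

(* Res_z z^(-s) F(z) x(z) for x(z) = sum_i x_i z^(-1-i). *)
Definition lres (K : comUnitRingType) (M : lmodType K) (s : nat) (F : pseries K)
    (x : int -> M) : M :=
  \sum_(m \in [set: nat]) F m *: x (m%:Z - s%:Z).

Lemma sum_ord_shift (V : zmodType) (h : nat -> V) m B : (m <= B)%N ->
  \sum_(l < B | (m <= l)%N) h l = \sum_(l < B - m) h (l + m)%N.
Proof.
move=> mB; rewrite -(big_mkord (fun l => (m <= l)%N) h) (big_cat_nat (n := m)) //=.
rewrite [X in X + _]big_nat_cond [X in X + _]big1 ?add0r; last first.
  by move=> l /andP[/andP[_ lm] ml]; move: lm; rewrite ltnNge ml.
transitivity (\sum_(0 + m <= l < B) h l); last by rewrite big_addn big_mkord.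
rewrite add0n [RHS]big_nat_cond [LHS]big_nat_cond; apply: eq_bigl => l.
by rewrite andbT; apply/andb_idr => /andP[].
Qed.

Section Pairing.
Variables (K : comUnitRingType) (M : lmodType K).
Implicit Types (F G : pseries K) (x y : int -> M) (X : int -> int -> M).

Lemma ub_ltn x (s : nat) : ubounded x -> exists B : nat,
  forall m : nat, (B <= m)%N -> x (m%:Z - s%:Z) = 0.
Proof. by move=> [B xB]; exists (absz (B + s%:Z)) => m Bm; apply: xB; lia. Qed.

Lemma lres_ffin s F x : ubounded x -> ffin (fun m : nat => F m *: x (m%:Z - s%:Z)).
Proof. by move=> /(ub_ltn s)[B xB]; exists B => m /xB ->; rewrite scaler0. Qed.

Lemma lresE s F x B : (forall m : nat, (B <= m)%N -> x (m%:Z - s%:Z) = 0) ->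
  lres s F x = \sum_(m < B) F m *: x (m%:Z - s%:Z).
Proof. by move=> xB; apply: fsum_ltn => m /xB ->; rewrite scaler0. Qed.

Lemma eq_lres s F x y : (forall i, - s%:Z <= i -> x i = y i) -> lres s F x = lres s F y.
Proof. by move=> xy; apply: eq_fsum => m; rewrite xy //; lia. Qed.

Lemma ubD x y : ubounded x -> ubounded y -> ubounded (fun i => x i + y i).
Proof.
move=> [B xB] [D yD]; exists (Num.max B D) => i; rewrite ge_max => /andP[Bi Di].
by rewrite xB ?yD ?addr0.
Qed.

Lemma ub_map (N : zmodType) (f : int -> M -> N) x :
  (forall i, f i 0 = 0) -> ubounded x -> ubounded (fun i => f i (x i)).
Proof. by move=> f0 [B xB]; exists B => i /xB ->. Qed.

Lemma ub_shift x r : ubounded x -> ubounded (fun i => x (i + r)).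
Proof. by move=> [B xB]; exists (B - r) => i Bi; apply: xB; lia. Qed.

Lemma lresD s F x y : ubounded x -> ubounded y ->
  lres s F (fun i => x i + y i) = lres s F x + lres s F y.
Proof.
move=> ux uy; rewrite /lres -fsumD; [|exact: lres_ffin..].
by apply: eq_fsum => m; rewrite scalerDr.
Qed.

Lemma lresZ s F c x : ubounded x -> lres s F (fun i => c *: x i) = c *: lres s F x.
Proof.
move=> ux; rewrite /lres (raddf_fsum (f := *:%R c)); first last.
- exact: lres_ffin.
- exact: scalerDr.
by apply: eq_fsum => m; rewrite !scalerA mulrC.
Qed.

Lemma lresDl s F G x : ubounded x -> lres s (F + G) x = lres s F x + lres s G x.
Proof.
move=> ux; rewrite /lres -fsumD; [|exact: lres_ffin..].
by apply: eq_fsum => m; rewrite -scalerDl.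
Qed.

Lemma lresNl s F x : ubounded x -> lres s (- F) x = - lres s F x.
Proof.
move=> ux; apply/eqP; rewrite -addr_eq0 -lresDl // addNr; apply/eqP.
by apply: fsum0 => m; rewrite scale0r.
Qed.

Lemma lresMn s F x n : ubounded x -> lres s (F *+ n) x = lres s F x *+ n.
Proof.
move=> ux; elim: n => [|n IH]; last by rewrite !mulrS lresDl // IH.
by apply: fsum0 => m; rewrite scale0r.
Qed.

Lemma ub_sum J (x : nat -> int -> M) : (forall t, ubounded (x t)) ->
  ubounded (fun i => \sum_(t < J) x t i).
Proof.
move=> ux; elim: J => [|J [B IH]]; first by exists 0 => i _; rewrite big_ord0.
have [D xD] := ux J; exists (Num.max B D) => i; rewrite ge_max => /andP[Bi Di].
by rewrite big_ord_recr /= IH // xD // addr0.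
Qed.

Lemma lres_sum s F J (x : nat -> int -> M) : (forall t, ubounded (x t)) ->
  lres s F (fun i => \sum_(t < J) x t i) = \sum_(t < J) lres s F (x t).
Proof.
move=> ux; elim: J => [|J IH].
  by rewrite big_ord0; apply: fsum0 => m; rewrite big_ord0 scaler0.
rewrite big_ord_recr /= -IH -lresD //; last exact: ub_sum.
congr lres.
by apply/funext => i; rewrite big_ord_recr.
Qed.

Lemma lres_lspan (S : set M) s F x : ubounded x ->
  (forall i, - s%:Z <= i -> x i \in lspan S) -> lres s F x \in lspan S.
Proof.
move=> /(ub_ltn s)[B xB] xO; rewrite (lresE _ xB) rpred_sum // => m _.
by rewrite rpredZ // xO //; lia.
Qed.

Lemma lres_gz g s F x : ubounded x -> lres s.+1 (psgz g * F) x = g *: lres s F x.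
Proof.
move=> ux; rewrite /lres fsum_recl; last exact: lres_ffin.
rewrite psgzM scale0r add0r (raddf_fsum (f := *:%R g)); first last.
- exact: lres_ffin.
- exact: scalerDr.
apply: eq_fsum => m; rewrite psgzM scalerA; congr (_ *: x _); lia.
Qed.

(** Integration by parts: i x_(i-1) are the modes of - x'(z), and the right side is the residue of
    (z^(-s) F)' x. *)
Lemma lres_deriv s F x : ubounded x ->
  lres s F (fun i => x (i - 1) *~ i) = lres s.+1 (pstheta F - F *+ s) x.
Proof.
move=> ux; apply: eq_fsum => m.
rewrite -[(pstheta F - F *+ s) m]/(m%:R * F m - (F *+ s) m).
have -> : (F *+ s) m = s%:R * F m.
  by elim: (s) => [|n IH]; rewrite ?mul0r // mulrS mulrSr mulrDl mul1r -IH addrC.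
rewrite -mulrBl mulrC -scalerA -scaler_int; congr (_ *: (_ *: x _)); last by lia.
by rewrite rmorphB.
Qed.

(** The substitution of -z for z: the modes (-1)^i x_i are those of - x(-z). *)
Lemma lres_refl s F x : ubounded x ->
  lres s F (fun i => x i *~ sgnz i) = lres s (psrefl F) x *~ (-1) ^+ s.
Proof.
move=> ux; have sgnE (m : nat) : sgnz (m%:Z - s%:Z) = (-1) ^+ m * (-1) ^+ s.
  rewrite /sgnz -exprD -signr_odd -[RHS]signr_odd; congr (_ ^+ nat_of_bool _).
  by rewrite oddD; lia.
rewrite /lres (raddf_fsum (f := fun v => v *~ (-1) ^+ s)); first last.
- exact: lres_ffin.
- by move=> ? ?; rewrite mulrzDl.
apply: eq_fsum => m; rewrite sgnE -!scaler_int !scalerA; congr (_ *: _).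
by rewrite !(rmorphM, rmorphXn, rmorphN1) /= /psrefl; ring.
Qed.

Lemma quadrant_swap X : quadrant_finite X -> quadrant_finite (fun i j => X j i).
Proof.
move=> Xf s t; have [B XB] := Xf t s; exists B => i j si tj Bij.
by apply: XB => //; rewrite orbC.
Qed.

Lemma quadrant_map (f : int -> int -> M -> M) X :
  (forall i j, f i j 0 = 0) -> quadrant_finite X -> quadrant_finite (fun i j => f i j (X i j)).
Proof.
move=> f0 Xf s t; have [B XB] := Xf s t; exists B => i j si tj Bij.
by rewrite XB.
Qed.

Lemma quadrant_shift X r r' : quadrant_finite X ->
  quadrant_finite (fun i j => X (i + r) (j + r')).
Proof.
move=> Xf s t; have [B XB] := Xf (s + r) (t + r').
exists (Num.max (B - r) (B - r')) => i j si tj Bij.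
apply: XB; lia.
Qed.

Lemma quadrant_add x : ubounded x -> quadrant_finite (fun i j => x (i + j)).
Proof. by move=> [B xB] s t; exists (Num.max (B - t) (B - s)) => i j si tj Bij; apply: xB; lia. Qed.

Lemma quadrant_ub X i : quadrant_finite X -> ubounded (X i).
Proof.
move=> /(_ i 0)[B XB]; exists (Num.max B 0) => j; rewrite ge_max => /andP[Bj j0].
by apply: XB; rewrite ?Bj ?orbT.
Qed.

Lemma ub_lres X t G : quadrant_finite X -> ubounded (fun i => lres t G (X i)).
Proof.
move=> /(_ 0 (- t%:Z))[B XB]; exists (Num.max B 0) => i; rewrite ge_max => /andP[Bi i0].
by apply: fsum0 => m; rewrite XB ?scaler0 ?Bi //; lia.
Qed.

Lemma exchange_lres X s F t G : quadrant_finite X ->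
  lres s F (fun i => lres t G (X i)) = lres t G (fun j => lres s F (fun i => X i j)).
Proof.
move=> Xf; have [B XB] := Xf (- s%:Z) (- t%:Z).
pose D := absz (Num.max (B + s%:Z) (B + t%:Z)).
rewrite (@lresE _ _ _ D); last first.
  by move=> m Dm; apply: fsum0 => m'; rewrite XB ?scaler0 //; lia.
rewrite [RHS](@lresE _ _ _ D); last first.
  by move=> m Dm; apply: fsum0 => m'; rewrite XB ?scaler0 //; lia.
under eq_bigr => m _.
  rewrite (@lresE _ _ _ D); last by move=> m' Dm; rewrite XB //; lia.
  rewrite scaler_sumr; over.
under [RHS]eq_bigr => m _.
  rewrite (@lresE _ _ _ D); last by move=> m' Dm; rewrite XB //; lia.
  rewrite scaler_sumr; over.
rewrite exchange_big; apply: eq_bigr => m _; apply: eq_bigr => m' _ /=.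
by rewrite !scalerA mulrC.
Qed.

(** The array x_(i+j) is that of x(w) delta(z-w), so pairing it with a function of z and one of w
    multiplies the two functions. *)
Lemma lres_mul s F t G x : ubounded x ->
  lres s F (fun i => lres t G (fun j => x (i + j))) = lres (s + t) (F * G) x.
Proof.
move=> ux; have [B xB] := ub_ltn (s + t) ux.
have e (m m' : nat) : x (m%:Z - s%:Z + (m'%:Z - t%:Z)) = x ((m + m')%N%:Z - (s + t)%N%:Z).
  by congr x; lia.
rewrite [RHS](lresE _ xB) (@lresE _ _ _ B); last first.
  by move=> m Bm; apply: fsum0 => m'; rewrite e xB ?scaler0 // (leq_trans Bm) // leq_addr.
transitivity (\sum_(m < B) \sum_(l < B | (m <= l)%N)
    (F m * G (l - m)%N) *: x (l%:Z - (s + t)%N%:Z)).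
  apply: eq_bigr => m _; have mB := ltnW (ltn_ord m).
  rewrite (@lresE _ _ _ (B - m)); last first.
    by move=> m' Bm; rewrite e xB // -leq_subLR.
  rewrite scaler_sumr (sum_ord_shift (fun l =>
    (F m * G (l - m)%N) *: x (l%:Z - (s + t)%N%:Z))) //.
  by apply: eq_bigr => m' _; rewrite e scalerA addnK addnC.
rewrite (exchange_big_dep xpredT) //=; apply: eq_bigr => l _.
rewrite pseriesME scaler_suml.
by rewrite (big_ord_widen_cond B xpredT (fun m => (F m * G (l - m)%N) *: x (l%:Z - (s + t)%N%:Z))).
Qed.

End Pairing.

Section ZhuPairing.
Variables (K : comUnitRingType) (M : lmodType K) (g : K).
Hypothesis charK0 : forall n, n.+1%:R \is a @GRing.unit K.
Variable S : set M.
Implicit Type x : int -> M.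

(* Res_z gamma^n e^(gamma z) / (e^(gamma z) - 1)^n x(z) *)
Definition zres n x : M := lres n (zhu_series g n) x.

Lemma zres_deriv n x : ubounded x -> zres n.+1 (fun i => x (i - 1) *~ i) =
  - (g *: zres n.+1 x *+ n) - zres n.+2 x *+ n.+1.
Proof.
move=> ux; rewrite /zres lres_deriv // pstheta_zhu_series //.
by rewrite lresDl // !lresNl // !lresMn // lres_gz.
Qed.

(** The modes on the left are those of (-d/dz)^t x / t!. Integrating by parts moves the derivatives
    to f_n, and those of f_n are combinations of the f_q with q >= n. *)
Lemma zres_divided_deriv n t x : ubounded x -> (0 < n)%N ->
  (forall q, (n <= q)%N -> zres q x \in lspan S) ->
  zres n (fun i => x (i - t%:Z) *~ binz i t) \in lspan S.
Proof.
move=> + n0; elim: t x => [|t IH] x ux xO.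
  rewrite (_ : (fun i => _) = x) ?xO //.
  by apply/funext => i; rewrite binz0 mulr1z subr0.
have ux' : ubounded (fun i => x (i - 1) *~ i).
  by have [B xB] := ux; exists (B + 1) => i Bi; rewrite xB ?mul0rz //; lia.
have /IH : forall q, (n <= q)%N -> zres q (fun i => x (i - 1) *~ i) \in lspan S.
  case=> [|q] nq; first by move: (leq_trans n0 nq).
  by rewrite zres_deriv // rpredB ?rpredN ?rpredMn ?rpredZ // xO // leqW.
move=> /(_ ux').
(* The induction hypothesis for the derivative of x gives t + 1 times the claim, which is then
   divided out. *)
rewrite (_ : (fun i => _) = fun i => t.+1%:R *: (x (i - t.+1%:Z) *~ binz i t.+1)).
  rewrite /zres lresZ => [h|]; last first.
    by apply: (ub_map (f := fun i v => v *~ binz i t.+1)) (ub_shift _ ux) => i; rewrite mul0rz.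
  rewrite -[X in X \in _]scale1r -(mulVr (charK0 t)) -scalerA; exact: rpredZ.
apply/funext => i; rewrite -mulrzA scaler_nat pmulrn -mulrzA binz_absorb.
by congr (x _ *~ _); lia.
Qed.

Lemma zres_mul m n x : ubounded x ->
  zres m (fun i => zres n.+1 (fun j => x (i + j))) =
  zres (m + n.+1) x + g *: zres (m + n) x.
Proof.
move=> ux; rewrite /zres lres_mul // zhu_seriesM // lresDl // addnS lres_gz //.
Qed.

(** The two residues collapse to one against f_1(z) f_n(-z), up to sign f_(n+1)(-z), which is a
    combination of kernels of index at least 2. *)
Lemma zres_refl n x : ubounded x -> (forall q, (2 <= q)%N -> zres q x \in lspan S) ->
  (0 < n)%N -> zres n (fun k => zres 1 (fun l => x (l + k)) *~ sgnz k) \in lspan S.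
Proof.
move=> ux xO; case: n => // n _.
rewrite (_ : (fun k => _) = fun k => lres 1 (zhu_series g 1) (fun l => x (k + l)) *~ sgnz k); last first.
  by apply/funext => k; rewrite /zres; congr (lres _ _ _ *~ _); apply/funext => l; rewrite addrC.
rewrite /zres lres_refl; last first.
  exact: (ub_lres _ _ (quadrant_add ux)).
rewrite rpredMz // lres_mul // mulrC zhu_series1_refl // addn1.
set E := psexp g : pseries K; set P := psinv (psphi g) : pseries K.
(* Each use of E P = P + gamma z removes one [E] and at most one [P], so i <= m keeps at least two
   factors [P] when a single [E] remains. *)
suff h i m : (i <= m)%N -> lres m.+2 (E ^+ i.+1 * P ^+ m.+2) x \in lspan S by exact: h.
elim: i m => [|i IH] m; first by move=> _; apply: xO.
case: m => // m im.
have -> : E ^+ i.+2 * P ^+ m.+3 = E ^+ i.+1 * P ^+ m.+3 + psgz g * (E ^+ i.+1 * P ^+ m.+2).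
  transitivity (E ^+ i.+1 * P ^+ m.+2 * (E * P)); first by rewrite !exprS; ring.
  by rewrite psexpMinv // -/P !exprS; ring.
by rewrite lresDl // lres_gz // rpredD ?rpredZ // IH // leqW.
Qed.

End ZhuPairing.

(** * The Zhu ideal *)

Section ZhuIdeal.
Variables (C : numFieldType) (V : lmodType C) (gr : bool -> set V)
  (Y : V -> int -> V -> V) (vac : V) (T : V -> V).
Hypothesis VA : vertex_superalgebra gr Y vac T.
Variables (K : comUnitRingType) (M : lmodType K) (g : K) (iota : V -> M).
Hypothesis charK0 : forall n, n.+1%:R \is a @GRing.unit K.
Hypothesis iotaD : {morph iota : x y / x + y}.

Implicit Types a b c v : V.

(** For gamma a number, [iota] is the identity of V over K = C; for gamma formal it embeds V as the
    constants of V[gamma] over K = C[gamma]. *)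
Definition zhu_op n a b : M := zres g n (fun i => iota (Y a i b)).

Variable S : set M.
Hypothesis S_op : forall n a b, (2 <= n)%N -> S (zhu_op n a b).

Let iota0 : iota 0 = 0. Proof. by apply: (@addrI _ (iota 0)); rewrite -iotaD !addr0. Qed.
Let iotaN v : iota (- v) = - iota v.
Proof. by apply: (@addrI _ (iota v)); rewrite -iotaD !subrr. Qed.
Let iotaMz v (z : int) : iota (v *~ z) = iota v *~ z.
Proof.
have iotaMn u n : iota (u *+ n) = iota u *+ n by elim: n => // n IH; rewrite !mulrS iotaD IH.
by case: z => n; rewrite -?pmulrn ?NegzE ?mulrNz ?iotaN iotaMn.
Qed.
Let iota_sum J (f : 'I_J -> V) : iota (\sum_(t < J) f t) = \sum_(t < J) iota (f t).
Proof. exact: (big_morph iota iotaD iota0). Qed.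
Let iota_sign n v : iota ((-1) ^+ n *: v) = (-1) ^+ n *: iota v.
Proof. by rewrite -signr_odd -[in RHS]signr_odd; case: odd; rewrite ?scaleN1r ?scale1r. Qed.

Lemma mem_lspan (x : M) : S x -> x \in lspan S.
Proof.
move=> Sx; apply/asboolP; exists [:: (1, x)]; last by rewrite big_seq1 scale1r.
by move=> q; rewrite inE => /eqP ->.
Qed.

Lemma zhu_op_lspan n a b : (2 <= n)%N -> zhu_op n a b \in lspan S.
Proof. by move=> n2; apply/mem_lspan/S_op. Qed.

Lemma Y_ub a b : ubounded (fun i => iota (Y a i b)).
Proof. by have [B aB] := va_trunc VA a b; exists B => i /aB ->. Qed.

(** The truncation bound in i depends on j, but b_j c is nonzero for only finitely many j >= t. *)
Lemma YY_quadrant a b c : quadrant_finite (fun i j => iota (Y a i (Y b j c))).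
Proof.
move=> s t; have [B1 bB] := va_trunc VA b c.
have [D aD] : exists D : int, forall k, (k < absz (B1 - t))%N ->
    forall i, D <= i -> Y a i (Y b (t + k%:Z) c) = 0.
  elim: absz => [|n [D IH]]; first by exists 0.
  have [D' aD'] := va_trunc VA a (Y b (t + n%:Z) c).
  exists (Num.max D D') => k; rewrite ltnS leq_eqVlt => /orP[/eqP ->|kn] i.
    by rewrite ge_max => /andP[_ /aD'].
  by rewrite ge_max => /andP[Di _]; apply: IH.
exists (Num.max B1 D) => i j si tj Bij.
have [Bj|jB] := leP B1 j; first by rewrite bB // (va_Y0r VA).
rewrite (_ : j = t + (absz (j - t))%:Z) ?aD //; lia.
Qed.

Lemma zhu_opDl n a a' b : zhu_op n (a + a') b = zhu_op n a b + zhu_op n a' b.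
Proof.
rewrite /zhu_op /zres -lresD; [|exact: Y_ub..].
by congr lres; apply/funext => i; rewrite (va_YDl VA) iotaD.
Qed.

Lemma zhu_opDr n a b b' : zhu_op n a (b + b') = zhu_op n a b + zhu_op n a b'.
Proof.
rewrite /zhu_op /zres -lresD; [|exact: Y_ub..].
by congr lres; apply/funext => i; rewrite (va_YDr VA) iotaD.
Qed.

Lemma zhu_opZl (h : C -> K) n (c : C) a b : (forall v, iota (c *: v) = h c *: iota v) ->
  zhu_op n (c *: a) b = h c *: zhu_op n a b.
Proof.
move=> iZ; rewrite /zhu_op /zres -lresZ; last exact: Y_ub.
by congr lres; apply/funext => i; rewrite (va_YZl VA) iZ.
Qed.

Lemma zhu_opZr (h : C -> K) n (c : C) a b : (forall v, iota (c *: v) = h c *: iota v) ->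
  zhu_op n a (c *: b) = h c *: zhu_op n a b.
Proof.
move=> iZ; rewrite /zhu_op /zres -lresZ; last exact: Y_ub.
by congr lres; apply/funext => i; rewrite (va_YZr VA) iZ.
Qed.

Section Homogeneous.
Variables (p q : bool) (a b : V).
Hypotheses (pa : gr p a) (qb : gr q b).

Let e : nat := (p * q)%N.

Lemma commutator_formula J c i j : supp_lt (fun t : nat => Y a t%:Z b) J ->
  Y a i (Y b j c) = (-1) ^+ e *: Y b j (Y a i c) +
  \sum_(t < J) Y (Y a t%:Z b) (i + j - t%:Z) c *~ binz i t.
Proof.
move=> abJ; have := borcherds_identity VA pa qb c i j 0.
rewrite !borcherdsR_nat !big_ord1 /= !mulr1z => /esym/eqP.
rewrite subr_eq !addr0 addrC => /eqP ->; congr (_ + _).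
by rewrite /borcherdsL (@fsum_ltn _ _ J) // => t /abJ; rewrite add0r => ->; rewrite (va_Y0l VA) mul0rz.
Qed.

Lemma iterate_formula J J' c k l :
  supp_lt (fun t : nat => Y b (l + t%:Z) c) J -> supp_lt (fun t : nat => Y a t%:Z c) J' ->
  Y (Y a k b) l c =
  \sum_(t < J) Y a (k - t%:Z) (Y b (l + t%:Z) c) *~ ((-1) ^+ t * binz k t) -
  (-1) ^+ e *: \sum_(t < J') Y b (l + k - t%:Z) (Y a t%:Z c) *~ ((-1) ^+ t * binz k t * sgnz k).
Proof.
move=> bJ aJ'; have := borcherds_identity VA pa qb c 0 l k.
rewrite /borcherdsL (@fsum_ltn _ _ 1) => [|j j0]; last by rewrite binz_nat_small ?mulr0z.
rewrite big_ord1 binz0 mulr1z !addr0 add0r => ->.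
rewrite /borcherdsR (@fsum_ltn _ _ J) => [|t /bJ ->]; last by rewrite (va_Y0r VA) mul0rz.
rewrite (@fsum_ltn _ _ J') => [|t]; last first.
  by rewrite add0r => /aJ' ->; rewrite (va_Y0r VA) mul0rz.
congr (_ - _).
  by apply: eq_bigr => t _; rewrite add0r.
rewrite -scaler_int scalerA mulrC -scalerA scaler_sumr; congr (_ *: _); apply: eq_bigr => t _.
by rewrite scaler_int -mulrzA add0r.
Qed.

(** The residue is a *_1 (b *_n c). The first term of the commutator formula gives combinations of b
    *_n (a_i c). In the others, after t integrations by parts, the residues collapse to pairings
    with f_r f_n, r >= 1, hence with f_(r+n) and f_(r+n-1), of index at least 2. *)
Lemma zhu_op_left_homogeneous n c : (2 <= n)%N ->
  zres g n (fun j => zhu_op 1 a (Y b j c)) \in lspan S.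
Proof.
move=> n2; have [J abJ] := trunc_ffin VA a b 0.
have {}abJ : supp_lt (fun t : nat => Y a t%:Z b) J by move=> t /abJ; rewrite add0r.
pose x t l := iota (Y (Y a t%:Z b) l c).
have ux t : ubounded (x t) by exact: Y_ub.
pose X t i j := x t (i + j - t%:Z) *~ binz i t.
have qX t : quadrant_finite (X t).
  apply: (quadrant_map (f := fun i j y => y *~ binz i t)
    (X := fun i j => x t (i + j - t%:Z))) => [i j|]; first by rewrite mul0rz.
  exact: (quadrant_add (ub_shift (- t%:Z) (ux t))).
pose X0 i j := (-1) ^+ e *: iota (Y b j (Y a i c)).
have qX0 : quadrant_finite X0.
  apply: (quadrant_map (f := fun i j y => (-1) ^+ e *: y)
    (X := fun i j => iota (Y b j (Y a i c)))) => [i j|]; first by rewrite scaler0.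
  exact/quadrant_swap/YY_quadrant.
have -> : (fun j => zhu_op 1 a (Y b j c)) = fun j =>
    zres g 1 (X0^~ j) + \sum_(t < J) zres g 1 (X t ^~ j).
  apply/funext => j; rewrite /zres -(lres_sum _ _ J (x := fun t i => X t i j)) => [|t]; last first.
    exact: (quadrant_ub j (quadrant_swap (qX t))).
  rewrite -lresD; first last.
  - apply: (ub_sum J (x := fun t i => X t i j)) => t.
    exact: (quadrant_ub j (quadrant_swap (qX t))).
  - exact: (quadrant_ub j (quadrant_swap qX0)).
  congr lres; apply/funext => i; rewrite (commutator_formula c i j abJ) iotaD iota_sign.
  by rewrite iota_sum; congr (_ + _); apply: eq_bigr => t _; rewrite iotaMz.
have u0 := ub_lres 1 (zhu_series g 1) (quadrant_swap qX0).
have uX t := ub_lres 1 (zhu_series g 1) (quadrant_swap (qX t)).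
rewrite /zres lresD //; last first.
  exact: (ub_sum J (x := fun t j => lres 1 (zhu_series g 1) (X t ^~ j))).
rewrite (lres_sum _ _ J (x := fun t j => lres 1 (zhu_series g 1) (X t ^~ j))) //.
apply: rpredD.
  rewrite exchange_lres; last exact: quadrant_swap.
  apply: lres_lspan => [|i _]; first exact: ub_lres.
  by rewrite lresZ ?rpredZ ?zhu_op_lspan //; exact: Y_ub.
apply: rpred_sum => t _; rewrite exchange_lres; last exact/quadrant_swap.
pose u i := zres g n (fun j => x t (i + j)).
have uu : ubounded u by exact/ub_lres/quadrant_add.
have -> : (fun i => lres n (zhu_series g n) (X t i)) = fun i => u (i - t%:Z) *~ binz i t.
  apply/funext => i; rewrite -scaler_int -lresZ; last exact: quadrant_ub (quadrant_add (ux t)).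
  by congr lres; apply/funext => j; rewrite scaler_int /X addrAC.
apply: (@zres_divided_deriv _ _ g charK0 S 1 t u) => // r r1.
case: n n2 @u uu => // n n2 u uu; rewrite /u zres_mul //.
by rewrite rpredD ?rpredZ //; apply: zhu_op_lspan; lia.
Qed.

(** The residue is (a *_n b) *_1 c. Integrating by parts in k, the terms with a outside become
    combinations of a *_q (b_l c), q >= n. In those with b outside, (-1)^k reflects the variable and
    [zres_refl] applies. *)
Lemma zhu_op_right_homogeneous n c : (2 <= n)%N ->
  zres g n (fun k => zhu_op 1 (Y a k b) c) \in lspan S.
Proof.
(* The kernel f_1 has a simple pole, so only l >= -1 occurs and one bound [J] serves all l. *)
move=> n2; have [J bJ] := trunc_ffin VA b c (-1).
have {}bJ l : -1 <= l -> supp_lt (fun t : nat => Y b (l + t%:Z) c) J.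
  move=> l1 t Jt; rewrite (_ : l + t%:Z = -1 + (absz (l + t%:Z + 1))%:Z); last by lia.
  by apply: bJ; lia.
have [J' aJ'] := trunc_ffin VA a c 0.
have {}aJ' : supp_lt (fun t : nat => Y a t%:Z c) J' by move=> t /aJ'; rewrite add0r.
pose X t k l := iota (Y a (k - t%:Z) (Y b (l + t%:Z) c)) *~ ((-1) ^+ t * binz k t).
have qX t : quadrant_finite (X t).
  apply: (quadrant_map (f := fun k l y => y *~ ((-1) ^+ t * binz k t))
    (X := fun k l => iota (Y a (k - t%:Z) (Y b (l + t%:Z) c)))) => [k l|].
    by rewrite mul0rz.
  exact: (quadrant_shift (- t%:Z) t%:Z (YY_quadrant a b c)).
pose x' t l := iota (Y b l (Y a t%:Z c)).
have ux' t : ubounded (x' t) by exact: Y_ub.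
pose X' t k l := x' t (l + k - t%:Z) *~ ((-1) ^+ t * binz k t * sgnz k) *~ (- (-1) ^+ e).
have qX' t : quadrant_finite (X' t).
  apply: (quadrant_map (f := fun k l y =>
    y *~ ((-1) ^+ t * binz k t * sgnz k) *~ (- (-1) ^+ e))
    (X := fun k l => x' t (l + k - t%:Z))) => [k l|].
    by rewrite !mul0rz.
  exact: (quadrant_swap (quadrant_add (ub_shift (- t%:Z) (ux' t)))).
have -> : (fun k => zhu_op 1 (Y a k b) c) = fun k =>
    \sum_(t < J) zres g 1 (X t k) + \sum_(t < J') zres g 1 (X' t k).
  apply/funext => k; rewrite /zres -(lres_sum _ _ J (x := X^~ k)) => [|t]; last exact: quadrant_ub.
  rewrite -(lres_sum _ _ J' (x := X'^~ k)) => [|t]; last exact: quadrant_ub.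
  rewrite -lresD; first last.
  - by apply: (ub_sum J' (x := X'^~ k)) => t; exact: quadrant_ub.
  - by apply: (ub_sum J (x := X^~ k)) => t; exact: quadrant_ub.
  apply: eq_lres => l l1; rewrite (iterate_formula k (bJ l l1) aJ') iotaD iotaN iota_sign.
  rewrite !iota_sum -scaleNr scaler_sumr; congr (_ + _); apply: eq_bigr => t _; rewrite iotaMz //.
  rewrite /X' -[RHS]scaler_int; congr (_ *: _).
  by rewrite rmorphN rmorphXn rmorphN1.
have uX t := ub_lres 1 (zhu_series g 1) (qX t).
have uX' t := ub_lres 1 (zhu_series g 1) (qX' t).
rewrite /zres lresD; first last.
- exact: (ub_sum J' (x := fun t k => lres 1 (zhu_series g 1) (X' t k))).
- exact: (ub_sum J (x := fun t k => lres 1 (zhu_series g 1) (X t k))).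
rewrite (lres_sum _ _ J (x := fun t k => lres 1 (zhu_series g 1) (X t k))) //.
rewrite (lres_sum _ _ J' (x := fun t k => lres 1 (zhu_series g 1) (X' t k))) //.
apply: rpredD; apply: rpred_sum => t _.
  rewrite exchange_lres //; apply: lres_lspan => [|l _]; first exact/ub_lres/quadrant_swap.
  pose y k := iota (Y a k (Y b (l + t%:Z) c)).
  have uy : ubounded y by exact: Y_ub.
  have -> : (fun k => X t k l) = fun k => (-1) ^+ t *: (y (k - t%:Z) *~ binz k t).
    apply/funext => k; rewrite /X mulrC mulrzA -scaler_int; congr (_ *: _).
    by rewrite rmorphXn rmorphN1.
  rewrite lresZ; last first.
    apply: (ub_map (f := fun i y => y *~ binz i t) (x := fun k => y (k - t%:Z))) => [i|].
      by rewrite mul0rz.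
    exact: (ub_shift (- t%:Z) uy).
  rewrite rpredZ //; apply: (zres_divided_deriv charK0 _ uy); first by lia.
  by move=> r nr; apply: zhu_op_lspan; lia.
pose u k := zres g 1 (fun l => x' t (l + k)) *~ sgnz k.
have uu : ubounded u.
  apply: (ub_map (f := fun k y => y *~ sgnz k)
    (x := fun k => zres g 1 (fun l => x' t (l + k)))) => [k|]; first by rewrite mul0rz.
  exact: (ub_lres _ _ (quadrant_swap (quadrant_add (ux' t)))).
have -> : (fun k => lres 1 (zhu_series g 1) (X' t k)) = fun k =>
    (- (-1) ^+ e) *: (u (k - t%:Z) *~ binz k t).
  apply/funext => k; rewrite /u /zres -mulrzA -scaler_int scalerA -lresZ; last first.
    exact: (quadrant_ub _ (quadrant_swap (quadrant_add (ux' t)))).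
  congr lres; apply/funext => l; rewrite /X' -mulrzA -scaler_int addrA; congr (_ *: _).
  rewrite sgnzB; rewrite !(rmorphM, rmorphN, rmorphXn, rmorphN1) /=; ring.
rewrite lresZ; last first.
  apply: (ub_map (f := fun i y => y *~ binz i t) (x := fun k => u (k - t%:Z))) => [i|].
    by rewrite mul0rz.
  exact: (ub_shift (- t%:Z) uu).
rewrite rpredZ //; apply: (zres_divided_deriv charK0 _ uu); first by lia.
move=> r nr; apply: zres_refl => //; last by lia.
by move=> r' r2; apply: zhu_op_lspan.
Qed.

End Homogeneous.

Lemma zhu_op_left n a b c : (2 <= n)%N ->
  zres g n (fun j => zhu_op 1 a (Y b j c)) \in lspan S.
Proof.
move=> n2; have ub a' b' : ubounded (fun j => zhu_op 1 a' (Y b' j c)).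
  exact: (ub_lres _ _ (quadrant_swap (YY_quadrant a' b' c))).
have [a0 [a1 [ga0 ga1 ->]]] := gr_split (va_gr VA) a.
have [b0 [b1 [gb0 gb1 ->]]] := gr_split (va_gr VA) b.
have -> : (fun j => zhu_op 1 (a0 + a1) (Y (b0 + b1) j c)) = fun j =>
    (zhu_op 1 a0 (Y b0 j c) + zhu_op 1 a0 (Y b1 j c)) +
    (zhu_op 1 a1 (Y b0 j c) + zhu_op 1 a1 (Y b1 j c)).
  by apply/funext => j; rewrite (va_YDl VA) zhu_opDl !zhu_opDr.
rewrite /zres !lresD //; try by apply: ubD.
by rewrite !rpredD //; [exact: (zhu_op_left_homogeneous ga0 gb0)
  | exact: (zhu_op_left_homogeneous ga0 gb1) | exact: (zhu_op_left_homogeneous ga1 gb0)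
  | exact: (zhu_op_left_homogeneous ga1 gb1)].
Qed.

Lemma zhu_op_right n a b c : (2 <= n)%N ->
  zres g n (fun k => zhu_op 1 (Y a k b) c) \in lspan S.
Proof.
move=> n2; have ub a' b' : ubounded (fun k => zhu_op 1 (Y a' k b') c).
  have [B aB] := va_trunc VA a' b'; exists B => k /aB ->.
  by apply: fsum0 => m; rewrite (va_Y0l VA) iota0 scaler0.
have [a0 [a1 [ga0 ga1 ->]]] := gr_split (va_gr VA) a.
have [b0 [b1 [gb0 gb1 ->]]] := gr_split (va_gr VA) b.
have -> : (fun k => zhu_op 1 (Y (a0 + a1) k (b0 + b1)) c) = fun k =>
    (zhu_op 1 (Y a0 k b0) c + zhu_op 1 (Y a0 k b1) c) +
    (zhu_op 1 (Y a1 k b0) c + zhu_op 1 (Y a1 k b1) c).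
  by apply/funext => k; rewrite (va_YDl VA) !(va_YDr VA) !zhu_opDl.
rewrite /zres !lresD //; try by apply: ubD.
by rewrite !rpredD //; [exact: (zhu_op_right_homogeneous ga0 gb0)
  | exact: (zhu_op_right_homogeneous ga0 gb1) | exact: (zhu_op_right_homogeneous ga1 gb0)
  | exact: (zhu_op_right_homogeneous ga1 gb1)].
Qed.

End ZhuIdeal.

(** * The induced differential *)

Section ZhuDifferential.
Variables (C : numFieldType) (V : lmodType C) (gr : bool -> set V)
  (Y : V -> int -> V -> V) (vac : V) (D : V -> V).
Hypothesis VA : vertex_superalgebra gr Y vac (D \o D).
Hypothesis D_der : forall p a i b, gr p a ->
  D (Y a i b) = Y (D a) i b + (-1) ^+ p *: Y a i (D b).

Variables (K : comUnitRingType) (M : lmodType K) (g : K) (iota : V -> M).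
Hypothesis charK0 : forall n, n.+1%:R \is a @GRing.unit K.
Hypothesis iotaD : {morph iota : x y / x + y}.

Variable S : set M.
Hypothesis SE : forall x,
  S x <-> exists n a b, (2 <= n)%N /\ x = zhu_op Y g iota n a b.

Variables (mul : M -> M -> M) (DM : M -> M) (grM : bool -> set M).
Hypothesis mul_linl : forall y, linear (mul^~ y).
Hypothesis mul_linr : forall x, linear (mul x).
Hypothesis mul_iota : forall a b, mul (iota a) (iota b) = zhu_op Y g iota 1 a b.
Hypothesis DM_lin : linear DM.
Hypothesis DM_iota : forall v, DM (iota v) = iota (D v).
Hypothesis spanM : forall x, exists s : seq (K * V), x = \sum_(q <- s) q.1 *: iota q.2.
Hypothesis spanM_gr : forall p x, grM p x ->
  exists2 s : seq (K * V), (forall q, q \in s -> gr p q.2) & x = \sum_(q <- s) q.1 *: iota q.2.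
Hypothesis DM_odd : forall p x, grM p x -> grM (~~ p) (DM x).

Implicit Types (a b : V) (x y : M).

Let linD (U W : lmodType K) (f : U -> W) : linear f -> {morph f : x y / x + y}.
Proof. by move=> fl x y; have := fl 1 x y; rewrite !scale1r. Qed.
Let lin0 (U W : lmodType K) (f : U -> W) : linear f -> f 0 = 0.
Proof. by move=> /linD fD; apply: (@addrI _ (f 0)); rewrite -fD !addr0. Qed.
Let linZ (U W : lmodType K) (f : U -> W) : linear f -> forall c u, f (c *: u) = c *: f u.
Proof. by move=> fl c u; have := fl c u 0; rewrite (lin0 fl) !addr0. Qed.
Let linN (U W : lmodType K) (f : U -> W) : linear f -> forall u, f (- u) = - f u.
Proof. by move=> fl u; rewrite -scaleN1r (linZ fl) scaleN1r. Qed.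
Let lin_sum (U W : lmodType K) (f : U -> W) (I : eqType) (s : seq I) (F : I -> U) :
  linear f -> f (\sum_(i <- s) F i) = \sum_(i <- s) f (F i).
Proof. by move=> fl; apply: (big_morph f (linD fl) (lin0 fl)). Qed.

Let linear_lres (f : M -> M) s F (x : int -> M) : linear f -> ubounded x ->
  f (lres s F x) = lres s F (fun i => f (x i)).
Proof.
move=> fl ux; rewrite /lres (raddf_fsum (linD fl)); last exact: lres_ffin.
by apply: eq_fsum => m; rewrite (linZ fl).
Qed.

Let Yu a b : ubounded (fun i => iota (Y a i b)).
Proof. exact: (Y_ub VA iotaD). Qed.

Let S_op n a b : (2 <= n)%N -> S (zhu_op Y g iota n a b).
Proof. by move=> n2; apply/SE; exists n, a, b. Qed.

Lemma linear_lspan (f : M -> M) : linear f ->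
  (forall n a b, (2 <= n)%N -> f (zhu_op Y g iota n a b) \in lspan S) ->
  forall x, x \in lspan S -> f x \in lspan S.
Proof.
move=> fl fS _ /asboolP[s Ss ->]; rewrite lin_sum // big_seq rpred_sum // => q qs.
by rewrite (linZ fl) rpredZ //; have /SE[n [a [b [n2 ->]]]] := Ss q qs; apply: fS.
Qed.

(** Multiplication by x is linear, so it passes under the finite residue sum defining b *_n c; this
    reduces the claim to [zhu_op_left]. *)
Lemma mul_lspanr x y : y \in lspan S -> mul x y \in lspan S.
Proof.
have [s ->] := spanM x; apply: linear_lspan => // n a b n2.
rewrite (@lin_sum _ _ (mul^~ (zhu_op Y g iota n a b))) // rpred_sum // => q _.
rewrite (linZ (mul_linl _)) rpredZ // linear_lres //.
have -> : (fun i => mul (iota q.2) (iota (Y a i b))) =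
    fun i => zhu_op Y g iota 1 q.2 (Y a i b) by apply/funext => i.
exact: (zhu_op_left VA charK0 iotaD S_op).
Qed.

Lemma mul_lspanl x y : x \in lspan S -> mul x y \in lspan S.
Proof.
have [s ->] := spanM y; apply: (linear_lspan (mul_linl _)) => n a b n2.
rewrite lin_sum // rpred_sum // => q _.
rewrite (linZ (mul_linr _)) rpredZ // (@linear_lres (mul^~ (iota q.2))) //.
have -> : (fun i => mul (iota (Y a i b)) (iota q.2)) =
    fun i => zhu_op Y g iota 1 (Y a i b) q.2 by apply/funext => i.
exact: (zhu_op_right VA charK0 iotaD S_op).
Qed.

Lemma cls_mul x x' y y' : cls S x = cls S x' -> cls S y = cls S y' ->
  cls S (mul x y) = cls S (mul x' y').
Proof.
move=> /cls_eq xx /cls_eq yy; apply/cls_eq.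
have -> : mul x y - mul x' y' = mul (x - x') y + mul x' (y - y').
  by rewrite (linD (mul_linl _)) (linN (mul_linl _)) (linD (mul_linr _)) (linN (mul_linr _)) addrA subrK.
by apply: rpredD; [exact: mul_lspanl | exact: mul_lspanr].
Qed.

Let iota_sign n v : iota ((-1) ^+ n *: v) = (-1) ^+ n *: iota v.
Proof.
have iota0 : iota 0 = 0 by apply: (@addrI _ (iota 0)); rewrite -iotaD !addr0.
have iotaN u : iota (- u) = - iota u by apply: (@addrI _ (iota u)); rewrite -iotaD !subrr.
by rewrite -signr_odd -[in RHS]signr_odd; case: odd; rewrite ?scaleN1r ?scale1r.
Qed.

Lemma DM_zhu_op n p a b : gr p a -> DM (zhu_op Y g iota n a b) =
  zhu_op Y g iota n (D a) b + (-1) ^+ p *: zhu_op Y g iota n a (D b).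
Proof.
move=> pa; rewrite linear_lres // /zhu_op /zres -lresZ // -lresD //.
  by congr lres; apply/funext => i; rewrite DM_iota (D_der _ _ pa) iotaD iota_sign.
apply: (ub_map (f := fun i y => (-1) ^+ p *: y) (x := fun i => iota (Y a i (D b)))) => [i|//].
by rewrite scaler0.
Qed.

Lemma DM_lspan x : x \in lspan S -> DM x \in lspan S.
Proof.
apply: linear_lspan => // n a b n2.
have [a0 [a1 [g0 g1 ->]]] := gr_split (va_gr VA) a.
rewrite (zhu_opDl VA g iotaD) (linD DM_lin) (DM_zhu_op _ _ g0) (DM_zhu_op _ _ g1).
by rewrite !rpredD ?rpredZ // mem_lspan //; apply: S_op.
Qed.

Lemma DM_mul p x y : grM p x -> DM (mul x y) = mul (DM x) y + (-1) ^+ p *: mul x (DM y).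
Proof.
move=> /spanM_gr[s gs ->]; have [t ->] := spanM y.
rewrite (@lin_sum _ _ (mul^~ _)) // !(lin_sum _ _ DM_lin) (@lin_sum _ _ (mul^~ _)) //.
rewrite (@lin_sum _ _ (mul^~ _)) // scaler_sumr -big_split.
apply: eq_big_seq => q qs /=.
rewrite !(lin_sum _ _ (mul_linr _)) lin_sum // scaler_sumr -big_split; apply: eq_bigr => r _ /=.
rewrite !(linZ DM_lin) !DM_iota !(linZ (mul_linr _)) !(linZ (mul_linl _)) !(linZ DM_lin) !mul_iota.
rewrite (DM_zhu_op _ _ (gs q qs)) !scalerDr !scalerA; congr (_ *: _ + _ *: _); ring.
Qed.

Lemma DM_square x : DM (DM x) \in lspan S.
Proof.
have [s ->] := spanM x; rewrite !lin_sum // rpred_sum // => q _.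
rewrite !(linZ DM_lin) !DM_iota rpredZ //.
suff -> : iota (D (D q.2)) = zhu_op Y g iota 2 q.2 vac by rewrite mem_lspan //; exact: S_op.
(* On the vacuum only the modes -2 and -1 survive. The second is weighted by the residue of f_2,
   which is 0, leaving a_(-2) vac. *)
rewrite /zhu_op /zres (@lresE _ _ _ _ _ 2); last first.
  have iota0 : iota 0 = 0 by apply: (@addrI _ (iota 0)); rewrite -iotaD !addr0.
  by move=> m m2; rewrite (va_vac_reg VA) ?iota0 //; lia.
rewrite !big_ord_recl big_ord0 /= zhu_series2_coef0 // zhu_series2_coef1 //.
rewrite scale0r !addr0 scale1r; congr iota.
have := va_T_der VA q.2 (-1) vac; rewrite (va_T_vac VA) (va_Y0r VA) (va_vac_val VA) /= => ->.
by rewrite sub0r rmorphN1 scaleN1r opprK.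
Qed.

Theorem zhu_differential : exists d : lquot S -> lquot S,
  (forall x, d (cls S x) = cls S (DM x)) /\ odd_differential (qgr grM) (qmul mul) d.
Proof.
pose d (u : lquot S) : lquot S := cls S (DM (repr u)).
have dE x : d (cls S x) = cls S (DM x).
  apply/cls_eq; rewrite -(linN DM_lin) -(linD DM_lin) DM_lspan //.
  by apply/cls_eq; rewrite cls_repr.
have mulE x y : qmul mul (cls S x) (cls S y) = cls S (mul x y).
  by apply: cls_mul; rewrite cls_repr.
have clsZE c x : cls S (c *: x) = c *: cls S x by exact: clsZ.
exists d; split=> //; split.
- move=> c u v; rewrite -[u]cls_repr -[v]cls_repr -clsZE -clsD !dE.
  by rewrite DM_lin clsD clsZE.
- by move=> p _ [x px <-]; exists (DM x); rewrite ?dE //; exact: DM_odd.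
- move=> p _ v [x px <-]; rewrite -[v]cls_repr mulE !dE !mulE (DM_mul _ px).
  by rewrite clsD clsZE.
- move=> u; rewrite -[u]cls_repr !dE.
  have -> : 0 = cls S (0 : M) by apply: (@addrI _ (cls S 0)); rewrite -clsD !addr0.
  by apply/cls_eq; rewrite subr0 DM_square.
Qed.

End ZhuDifferential.

(** * The vertex superalgebra underlying a SUSY vertex algebra *)

Section SusyModes.
Variables (C : numFieldType) (N : nat) (V : lmodType C) (S : susy_va N V) (k : 'I_N).

(* The modes of a(z, 0, ..., 0). *)
Definition body_mode (a : V) (i : int) (b : V) : V := mode S a i (~: finset.set0) b.

Let Y := body_mode.
Let D : V -> V := oddT S k.
Let Yk (a : V) (i : int) (b : V) : V := mode S a i (~: [set k]%SET) b.

Let field0 a i b : field_of (mode S) a (- 1 - i) finset.set0 b = Y a i b.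
Proof. by rewrite /field_of /Y /body_mode subKr. Qed.

Let field1 a i b : field_of (mode S) a (- 1 - i) [set k]%SET b = Yk a i b.
Proof. by rewrite /field_of /Yk subKr. Qed.

Let DD x y : D (x + y) = D x + D y. Proof. exact: raddfD. Qed.
Let DZ c x : D (c *: x) = c *: D x. Proof. exact: linearZ. Qed.
Let DN x : D (- x) = - D x. Proof. exact: raddfN. Qed.

Let DY p a i b : gr S p a -> D (Y a i b) = Yk a i b + (-1) ^+ p *: Y a i (D b).
Proof.
move=> pa; have := translation k pa (- 1 - i) finset.set0 b.
rewrite /odd_bracket /dzeta /mul_zeta finset.inE finset.setU0 cards0 expr0 scale1r subr0.
have -> : nbefore k finset.set0 = 0%N.
  by apply: eq_card0 => j; rewrite !inE.
rewrite expr0 scale1r field0 field1 field0.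
by move=> /eqP; rewrite subr_eq => /eqP.
Qed.

Let DYk p a i b : gr S p a ->
  D (Yk a i b) = - ((-1) ^+ p *: Yk a i (D b)) - i%:~R *: Y a (i - 1) b.
Proof.
move=> pa; have := translation k pa (- 1 - i) [set k]%SET b.
rewrite /odd_bracket /dzeta /mul_zeta /dz finset.set11 cards1 expr1 scaleN1r sub0r.
have -> : nbefore k [set k]%SET = 0%N.
  by apply: eq_card0 => j; rewrite !inE; case: eqP => // ->; rewrite ltnn.
rewrite expr0 scale1r field1 field1 finset.setDv.
rewrite (_ : - 1 - i + 1 = - 1 - (i - 1)); last by lia.
rewrite field0 -/D => /eqP; rewrite subr_eq eqr_oppLR opprD opprK => /eqP ->.
rewrite addrC; congr (_ + _); rewrite -scaleNr -rmorphN /=; congr (_%:~R *: _); lia.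
Qed.

Let YD a i x y : Y a i (x + y) = Y a i x + Y a i y.
Proof. exact: raddfD. Qed.
Let YDl a a' i b : Y (a + a') i b = Y a i b + Y a' i b.
Proof. by have := mode_linear S i (~: finset.set0) b 1 a a'; rewrite !scale1r. Qed.

(** D anticommutes with the odd operator d_zeta - zeta d_z, so D^2 brackets as minus the square of
    that operator, which is d/dz. *)
Let DD_der a i b : D (D (Y a i b)) = Y a i (D (D b)) - i%:~R *: Y a (i - 1) b.
Proof.
have homog p a' : gr S p a' ->
    D (D (Y a' i b)) = Y a' i (D (D b)) - i%:~R *: Y a' (i - 1) b.
  move=> pa; rewrite (DY _ _ pa) DD DZ (DYk _ _ pa) (DY _ _ pa).
  rewrite scalerDr scalerA -expr2 sqrr_sign scale1r addrA addrC; congr (_ + _).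
  by rewrite addrAC addNr add0r.
have [a0 [a1 [g0 g1 ->]]] := gr_split (gr_super S) a.
by rewrite !YDl !DD (homog _ _ g0) (homog _ _ g1) scalerDr opprD addrACA.
Qed.

Lemma iter_mul_zw M (H : distr2 N V) K L v m n :
  iter M (@mul_zw C N V) H m n K L v =
  dlt M (fun i j => H (- 1 - i) (- 1 - j) K L v) (- 1 - m) (- 1 - n).
Proof.
rewrite -dlt_iter; elim: M m n => [|M IH] m n; first by rewrite /= !subKr.
rewrite !iterS /mul_zw !IH /=.
by rewrite !(_ : forall x : int, - 1 - (x - 1) = - 1 - x + 1) // => x; lia.
Qed.

(** The zeta^k component of a has the opposite parity, whence [~~ p]. This is also the parity of D
    a, so [goddard] can compare the two fields. *)
Let susy_local p q a b : gr S p a -> gr S q b -> exists M, forall i j v,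
  dlt M (fun i j => Y a i (Y b j v) - (-1) ^+ (p * q) *: Y b j (Y a i v)) i j = 0 /\
  dlt M (fun i j => Yk a i (Y b j v) - (-1) ^+ (~~ p * q) *: Y b j (Yk a i v)) i j = 0.
Proof.
move=> pa qb; have [M loc] := locality pa qb; exists M => i j v; split.
  have := loc (- 1 - i) (- 1 - j) finset.set0 finset.set0 v.
  rewrite iter_mul_zw !subKr => h; rewrite -[RHS]h; congr (dlt _ _ _ _).
  apply/funext => i'; apply/funext => j'; rewrite /bracket cards0 !muln0 addn0.
  by rewrite expr0 scale1r !field0.
have := loc (- 1 - i) (- 1 - j) [set k]%SET finset.set0 v.
rewrite iter_mul_zw !subKr => h; rewrite -[RHS]h; congr (dlt _ _ _ _).
apply/funext => i'; apply/funext => j'; rewrite /bracket cards0 cards1 !muln0 muln1.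
rewrite expr0 scale1r !field0 !field1; congr (_ - _ *: _).
by case: (p) (q) => [] []; rewrite //= expr2 mulrNN mulr1.
Qed.

Lemma susy_vertex_superalgebra : 
  vertex_superalgebra (gr S) body_mode (vac S) (oddT S k \o oddT S k).
Proof.
split.
- exact: gr_super.
- by move=> i b; exact: mode_linear.
- by move=> a i c x y; exact: linearP.
- move=> p q a b i pa qb; have := mode_even i (~: finset.set0) pa qb.
  by rewrite finset.setCK cards0 addbF.
- move=> a b; have [B aB] := field_laurent S a b; exists (- B) => i Bi.
  by rewrite -/(Y a i b) -field0 aB //; lia.
- exact: vac_even.
- by move=> a i i0; rewrite -/(Y a i _) -field0 field_on_vac_reg //; lia.
- by move=> a; rewrite -/(Y a _ _) -field0 (_ : - 1 - - 1 = 0) ?field_on_vac_val //; lia.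
- by move=> c x y; rewrite /= /D !linearP.
- by rewrite /= /D oddT_vac raddf0.
- by move=> a i b; exact: DD_der.
- move=> p q a b pa qb; have [M loc] := susy_local pa qb.
  by exists M => i j v; have [] := loc i j v.
Qed.

Let VA := susy_vertex_superalgebra.
Let Yvac_reg a i : 0 <= i -> Y a i (vac S) = 0. Proof. exact: (va_vac_reg VA). Qed.
Let Yvac_val a : Y a (- 1) (vac S) = a. Proof. exact: (va_vac_val VA). Qed.

(* Goddard's uniqueness theorem. *)
Let goddard p q a b i : gr S p a -> gr S q b -> (forall i, Yk a i (vac S) = Y (D a) i (vac S)) ->
  Yk a i b = Y (D a) i b.
Proof.
move=> pa qb vacE; have [M1 loc1] := susy_local pa qb.
have [M2 loc2] := susy_local (oddT_odd k pa) qb.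
pose M := maxn M1 M2; pose s : C := (-1) ^+ (~~ p * q).
pose G i x := Yk a i x - Y (D a) i x.
have G0 x : G x 0 = 0 by rewrite /G /Y /body_mode /Yk !raddf0 addr0.
have GL i' j : dlt M (fun i j => G i (Y b j (vac S))) i' j = 0.
  rewrite (_ : (fun i j => _) = fun i j =>
     (Yk a i (Y b j (vac S)) - s *: Y b j (Yk a i (vac S))) +
     - (Y (D a) i (Y b j (vac S)) - s *: Y b j (Y (D a) i (vac S)))); last first.
    by apply/funext => i1; apply/funext => j1; rewrite vacE opprB addrA subrK.
  rewrite dltD -(@raddf_dlt _ _ -%R); last exact: opprD.
  rewrite (dlt_le (leq_maxl M1 M2)) => [|i1 j1]; last by have [] := loc1 i1 j1 (vac S).
  rewrite (dlt_le (leq_maxr M1 M2)) ?oppr0 ?addr0 // => i1 j1.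
  by have [] := loc2 i1 j1 (vac S).
(* At mode -1 of b all terms but the leading one involve b_j vac with j >= 0 and vanish; the leading
   one is the difference at i applied to b. *)
have := GL (i - M%:Z) (- 1); rewrite /dlt big_ord_recl big1 => [|t _]; last first.
  by rewrite Yvac_reg ?G0 ?mul0rz.
rewrite bin0 mulr1z addr0 subn0 subrK addr0 Yvac_val => /eqP.
by rewrite subr_eq0 => /eqP.
Qed.

(** True at i = -1. Since D^2 commutes with D and sends a_i vac to -i a_(i-1) vac, it descends to
    all smaller i. *)
Let D_vac a i : D (Y a i (vac S)) = Y (D a) i (vac S).
Proof.
have [i0|] := leP 0 i; first by rewrite !Yvac_reg // /D raddf0.
case: i => // n _; elim: n => [|n IH]; first by rewrite !Yvac_val.
have e : Negz n - 1 = Negz n.+1 by lia.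
have n0 : (Negz n)%:~R != 0 :> C by rewrite intr_eq0.
apply: (scalerI n0); rewrite -!DZ.
have der a' := va_T_der VA a' (Negz n) (vac S).
have {}der a' : (Negz n)%:~R *: Y a' (Negz n.+1) (vac S) = - D (D (Y a' (Negz n) (vac S))).
  by have := der a'; rewrite e (va_T_vac VA) (va_Y0r VA) sub0r /= -/D -/Y => ->; rewrite opprK.
by rewrite !der -IH DN.
Qed.

(** As D kills the vacuum, the zeta^k component of a takes a_j vac to D (a_j vac) there, hence
    agrees with D a on the vacuum; [goddard] extends this to every b. *)
Lemma oddT_derivation p a i b : gr S p a ->
  oddT S k (body_mode a i b) =
  body_mode (oddT S k a) i b + (-1) ^+ p *: body_mode a i (oddT S k b).
Proof.
move=> pa; rewrite -/D -/Y (DY _ _ pa); congr (_ + _).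
have vacE j : Yk a j (vac S) = Y (D a) j (vac S).
  by rewrite -D_vac (DY _ _ pa) /D oddT_vac /Y /body_mode raddf0 scaler0 addr0.
have [b0 [b1 [g0 g1 ->]]] := gr_split (gr_super S) b.
by rewrite YD -(goddard _ pa g0) // -(goddard _ pa g1) // /Yk raddfD.
Qed.

End SusyModes.

(** * The two cases of gamma *)

Section PolyExtension.
Variables (C : fieldType) (V : lmodType C).

Lemma vconstD : {morph (@vconst C V) : x y / x + y}.
Proof.
move=> x y; apply: vpolyP => n; rewrite -[RHS]/(vconst x n + vconst y n).
by case: n => [|n] //=; rewrite addr0.
Qed.

Lemma vconst0 : @vconst C V 0 = 0.
Proof. by apply: vpolyP => -[]. Qed.

Lemma vscale_polyC c (f : vpoly V) n : (c%:P *: f) n = c *: f n.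
Proof.
rewrite -[LHS]/(vscale_fun c%:P f n) /vscale_fun big_ord_recl coefC subn0.
by rewrite big1 ?addr0 // => i _; rewrite coefC scale0r.
Qed.

Lemma vscale_polyX (f : vpoly V) n : ('X *: f : vpoly V) n = if n is m.+1 then f m else 0.
Proof.
rewrite -[LHS]/(vscale_fun 'X f n) /vscale_fun; case: n => [|n].
  by rewrite big_ord1 coefX scale0r.
rewrite !big_ord_recl !coefX scale0r add0r scale1r subSS subn0.
by rewrite big1 ?addr0 // => i _; rewrite coefX scale0r.
Qed.

Lemma vscale_polyXn j (f : vpoly V) n :
  ('X^j *: f : vpoly V) n = if (j <= n)%N then f (n - j)%N else 0.
Proof.
elim: j n => [|j IH] n; first by rewrite expr0 scale1r subn0.
by rewrite exprS -scalerA vscale_polyX; case: n.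
Qed.

Lemma vconstZ c v : @vconst C V (c *: v) = c%:P *: vconst v.
Proof. by apply: vpolyP => n; rewrite vscale_polyC /=; case: eqP => // _; rewrite scaler0. Qed.

Lemma vpoly_ffin (f : vpoly V) : ffin f.
Proof. by case: f => f /= /asboolP. Qed.

Lemma vpoly_sum (f : vpoly V) B : supp_lt f B -> f = \sum_(j < B) 'X^j *: vconst (f j).
Proof.
move=> fB; apply: vpolyP => n.
have coefS (I : Type) (s : seq I) (F : I -> vpoly V) :
    (\sum_(i <- s) F i) n = \sum_(i <- s) F i n.
  by elim: s => [|i s IH]; rewrite ?big_nil // !big_cons -IH.
have termE j : ('X^j *: vconst (f j) : vpoly V) n = if j == n then f n else 0.
  rewrite vscale_polyXn; have [->|jn] := eqVneq j n; first by rewrite leqnn subnn.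
  case: ifP => // le_jn; rewrite -[LHS]/(if (n - j)%N == 0%N then f j else 0).
  by rewrite subn_eq0 leqNgt ltn_neqAle jn le_jn.
rewrite coefS; under eq_bigr do rewrite termE.
have [nB|Bn] := ltnP n B; last first.
  by rewrite fB // big1 // => j _; rewrite if_same.
rewrite (bigD1 (Ordinal nB)) //= eqxx big1 ?addr0 // => j jn.
by case: eqP => // e; case/eqP: jn; apply: val_inj.
Qed.

Variables (M : lmodType {poly C}) (phi : V -> M).
Hypothesis phiD : {morph phi : x y / x + y}.
Hypothesis phiZ : forall c v, phi (c *: v) = c%:P *: phi v.

Let phi0 : phi 0 = 0. Proof. by apply: (@addrI _ (phi 0)); rewrite -phiD !addr0. Qed.

(** The C[gamma]-linear extension of [phi] from V to V[gamma]. *)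
Definition vext (f : vpoly V) : M := \sum_(i \in [set: nat]) 'X^i *: phi (f i).

Lemma vext_ffin (f : vpoly V) : ffin (fun i => 'X^i *: phi (f i)).
Proof. by have [B fB] := vpoly_ffin f; exists B => i /fB ->; rewrite phi0 scaler0. Qed.

Lemma vext_const v : vext (vconst v) = phi v.
Proof.
rewrite /vext (@fsum_ltn _ _ 1) => [|[|j] // _]; last by rewrite /= phi0 scaler0.
by rewrite big_ord1 expr0 scale1r.
Qed.

Lemma vextD f h : vext (f + h) = vext f + vext h.
Proof.
rewrite /vext -fsumD; [|exact: vext_ffin..].
by apply: eq_fsum => i; rewrite -scalerDr -phiD.
Qed.

Lemma vext_linear : linear vext.
Proof.
have vextC c f : vext (c%:P *: f) = c%:P *: vext f.
  rewrite /vext (raddf_fsum (f := *:%R c%:P)); [|exact: scalerDr|exact: vext_ffin].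
  by apply: eq_fsum => i; rewrite vscale_polyC phiZ !scalerA mulrC.
have vextX f : vext ('X *: f) = 'X *: vext f.
  rewrite /vext (raddf_fsum (f := *:%R 'X)); [|exact: scalerDr|exact: vext_ffin].
  rewrite [LHS]fsum_recl; last exact: vext_ffin.
  rewrite vscale_polyX phi0 scaler0 add0r; apply: eq_fsum => i.
  by rewrite vscale_polyX scalerA exprS.
move=> p f h; rewrite vextD; congr (_ + _).
elim/poly_ind: p f => [|p c IH] f.
  rewrite !scale0r; apply: (@addrI _ (vext 0)); by rewrite -vextD !addr0.
by rewrite !scalerDl -!scalerA vextD IH vextX vextC.
Qed.

Lemma vmap_linear (T : {linear V -> V}) : linear (vmap T).
Proof.
move=> p f h; apply: vpolyP => n.
rewrite -[RHS]/(vscale_fun p (vmap T f) n + T (h n)).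
rewrite -[LHS]/(T (vscale_fun p f n + h n)) linearD; congr (_ + _).
by rewrite /vscale_fun linear_sum; apply: eq_bigr => i _; rewrite linearZ.
Qed.

End PolyExtension.

Section SusyZhu.
Variables (C : numFieldType) (N : nat) (V : lmodType C) (S : susy_va N V) (k : 'I_N).

Let VA := susy_vertex_superalgebra S k.

Lemma res_bulletE (K : comUnitRingType) (M : lmodType K) (iota : V -> M) (g : K) n a b :
  {morph iota : x y / x + y} ->
  res_bullet S iota g n a b = zhu_op (body_mode S) g iota n a b.
Proof.
move=> iotaD; have [B xB] := ub_ltn n (Y_ub VA iotaD a b).
rewrite /res_bullet (@fsum_int_ltn _ _ n B) => [|i ni|i Bi]; first last.
- rewrite /field_of subKr (_ : i = (absz (i + n%:Z))%:Z - n%:Z); last by lia.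
  by rewrite xB ?scaler0 //; lia.
- rewrite zhu_kernelE; case E : (i + n%:Z) => [m|m]; last by rewrite scale0r.
  by lia.
rewrite /zhu_op /zres (lresE _ xB); apply: eq_bigr => m _.
by rewrite zhu_kernelE subrK /field_of subKr.
Qed.

Lemma charC0_unit n : n.+1%:R \is a @GRing.unit C.
Proof. by rewrite unitfE pnatr_eq0. Qed.

(** The separate definition at gamma = 0 agrees with the residue: there [psexp] and [psphi] are 1,
    so the kernel is z^(-n). *)
Lemma bulletE g n a b : bullet S g n a b = zhu_op (body_mode S) g id n a b.
Proof.
rewrite /bullet; case: eqP => [->|_]; last exact: res_bulletE.
have one0 : psexp 0 = 1 :> pseries C.
  by apply/funext => -[|m]; rewrite /psexp pseries1E ?expr0 ?fact0 ?divr1 // expr0n mul0r.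
have phi0 : psphi 0 = 1 :> pseries C.
  by apply/funext => -[|m]; rewrite /psphi pseries1E ?expr0 ?divr1 // expr0n mul0r.
have ser0 : zhu_series (0 : C) n = 1.
  have := psphiV (0 : C); rewrite /zhu_series phi0 one0 !mul1r => ->.
  by rewrite expr1n.
rewrite /zhu_op /zres /lres (@fsum_ltn _ _ 1) => [|[|m] // _]; last first.
  by rewrite ser0 pseries1E scale0r.
by rewrite big_ord1 ser0 pseries1E scale1r sub0r /body_mode finset.setC0.
Qed.

Lemma zhu_differential_number (g : C) : exists d : zhu S g -> zhu S g,
  (forall a, d (zhu_cls S g a) = zhu_cls S g (oddT S k a)) /\
  odd_differential (zhu_gr S g) (zhu_mul S g) d.
Proof.
have idD : {morph (@id V) : x y / x + y} by [].
apply: (@zhu_differential _ _ _ _ _ _ VA _ _ _ g id _ _ (zhu_gen S g) _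
  (bullet S g 1) (oddT S k) (gr S)).
- exact: oddT_derivation.
- exact: charC0_unit.
- exact: idD.
- by move=> x; split=> -[n [a [b [n2 ->]]]]; exists n, a, b; rewrite bulletE.
- move=> y c a a'; rewrite !bulletE (zhu_opDl VA) //; congr (_ + _).
  exact: (zhu_opZl VA g idD (h := id)).
- move=> y c a a'; rewrite !bulletE (zhu_opDr VA) //; congr (_ + _).
  exact: (zhu_opZr VA g idD (h := id)).
- by move=> a b; rewrite bulletE.
- exact: linearP.
- by [].
- by move=> x; exists [:: (1, x)]; rewrite big_seq1 scale1r.
- move=> p x px; exists [:: (1, x)]; last by rewrite big_seq1 scale1r.
  by move=> q; rewrite inE => /eqP ->.
- exact: oddT_odd.
Qed.

Let fbulletE n a b : fbullet S n a b = zhu_op (body_mode S) 'X (@vconst C V) n a b.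
Proof. exact/res_bulletE/vconstD. Qed.

Let fbulletDl n b : {morph (fun a => fbullet S n a b) : x y / x + y}.
Proof. by move=> x y; rewrite !fbulletE (zhu_opDl VA _ (@vconstD C V)). Qed.
Let fbulletDr n a : {morph fbullet S n a : x y / x + y}.
Proof. by move=> x y; rewrite !fbulletE (zhu_opDr VA _ (@vconstD C V)). Qed.
Let fbulletZl n c a b : fbullet S n (c *: a) b = c%:P *: fbullet S n a b.
Proof. rewrite !fbulletE; apply: (zhu_opZl VA) => [|v]; [exact: vconstD | exact: vconstZ]. Qed.
Let fbulletZr n c a b : fbullet S n a (c *: b) = c%:P *: fbullet S n a b.
Proof. rewrite !fbulletE; apply: (zhu_opZr VA) => [|v]; [exact: vconstD | exact: vconstZ]. Qed.

(** As nested extensions, the double sum inherits its linearity in each argument from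
    [vext_linear]. *)
Lemma fbullet1E f h : fbullet1 S f h = vext (fun a => vext (fbullet S 1 a) h) f.
Proof.
apply: eq_fsum => i; rewrite /vext (raddf_fsum (f := *:%R 'X^i)); first last.
- exact: (vext_ffin (fbulletDr 1 _)).
- exact: scalerDr.
by apply: eq_fsum => j; rewrite scalerA exprD.
Qed.

Lemma fbullet1_linl h : linear (fun f => fbullet1 S f h).
Proof.
move=> p f f'; rewrite !fbullet1E vext_linear // => [a a'|c a]; rewrite /vext.
  rewrite -fsumD; [|exact: (vext_ffin (fbulletDr 1 _))..].
  by apply: eq_fsum => i; rewrite fbulletDl scalerDr.
rewrite (raddf_fsum (f := *:%R c%:P)); first last.
- exact: (vext_ffin (fbulletDr 1 _)).
- exact: scalerDr.
by apply: eq_fsum => i; rewrite fbulletZl !scalerA mulrC.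
Qed.

Lemma fbullet1_linr f : linear (fbullet1 S f).
Proof.
move=> p h h'; rewrite !fbullet1E.
have lin a := vext_linear (fbulletDr 1 a) (fbulletZr 1 ^~ a).
have ff h0 : ffin (fun i => 'X^i *: vext (fbullet S 1 (f i)) h0).
  have [B fB] := vpoly_ffin f; exists B => i /fB ->; rewrite /vext fsum0 ?scaler0 // => j.
  by rewrite fbulletE /zhu_op /zres /lres fsum0 ?scaler0 // => m; rewrite (va_Y0l VA) vconst0 scaler0.
rewrite [in RHS]/vext (raddf_fsum (f := *:%R p)); [|exact: scalerDr|exact: ff].
rewrite -fsumD; [|by have [B fB] := ff h; exists B => i /fB ->; rewrite scaler0|exact: ff].
by apply: eq_fsum => i; rewrite lin scalerDr !scalerA [p * _]mulrC.
Qed.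

Lemma zhu_differential_formal : exists d : fzhu S -> fzhu S,
  (forall f : vpoly V, d (fzhu_cls S f) = fzhu_cls S (vmap (oddT S k) f)) /\
  odd_differential (fzhu_gr S) (fzhu_mul S) d.
Proof.
have charP0 n : n.+1%:R \is a @GRing.unit {poly C}.
  by rewrite -polyC_natr rmorph_unit // charC0_unit.
have spanP (f : vpoly V) : exists B, f = \sum_(j < B) 'X^j *: vconst (f j).
  by have [B fB] := vpoly_ffin f; exists B; exact: vpoly_sum.
apply: (@zhu_differential _ _ _ _ _ _ VA _ _ _ 'X (@vconst C V) _ _ (fzhu_gen S) _
  (fbullet1 S) (vmap (oddT S k)) (fgr S)).
- exact: oddT_derivation.
- exact: charP0.
- exact: vconstD.
- by move=> x; split=> -[n [a [b [n2 ->]]]]; exists n, a, b; rewrite fbulletE.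
- exact: fbullet1_linl.
- exact: fbullet1_linr.
- move=> a b; rewrite fbullet1E vext_const => [|x y].
    by rewrite vext_const ?fbulletE //; exact: fbulletDr.
  by rewrite !vext_const ?fbulletDl //; exact: fbulletDr.
- exact: vmap_linear.
- by move=> v; apply: vpolyP => -[|n] //=; rewrite raddf0.
- move=> f; have [B fE] := spanP f.
  exists [seq ('X^j, f j) | j : 'I_B]; rewrite big_map big_enum; exact: fE.
- move=> p f pf; have [B fE] := spanP f.
  exists [seq ('X^j, f j) | j : 'I_B]; last by rewrite big_map big_enum; exact: fE.
  by move=> q /mapP[j _ ->]; exact: pf.
- by move=> p f pf n; exact: oddT_odd.
Qed.

End SusyZhu.

Theorem proposition3p10 (R : realType) (N : nat) (hN : (1 <= N)%N)
    (V : lmodType R[i]) (S : susy_va N V) (k : 'I_N) :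
  (forall gamma : R[i],
     exists d : zhu S gamma -> zhu S gamma,
       (forall a : V, d (zhu_cls S gamma a) = zhu_cls S gamma (oddT S k a)) /\
       odd_differential (zhu_gr S gamma) (zhu_mul S gamma) d) /\
  (exists d : fzhu S -> fzhu S,
     (forall f : vpoly V, d (fzhu_cls S f) = fzhu_cls S (vmap (oddT S k) f)) /\
     odd_differential (fzhu_gr S) (fzhu_mul S) d).
Proof.
split; last exact: zhu_differential_formal.
by move=> gamma; exact: zhu_differential_number.
Qed.
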